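(* Let $\pi_1,\pi_2$ be two policies in a Markov decision process whose state-action pairs are represented as vectors in $\mathbb{R}^d$, with occupancy measures $\rho_1,\rho_2$ (distributions on $\mathbb{R}^d$). Fix $\sigma>0$ and $D\in\mathbb{N}$, draw $\mathbf{w}_1,\dots,\mathbf{w}_D\sim\mathcal{N}(0,\sigma^{-2}I_d)$ and $b_1,\dots,b_D\sim\mathcal{U}(0,2\pi)$ independently, and define the random Fourier feature map $\phi:\mathbb{R}^d\to\mathbb{R}^D$ by $\phi(x)=\sqrt{2/D}\,\big(\cos(\mathbf{w}_1^T x+b_1),\dots,\cos(\mathbf{w}_D^T x+b_D)\big)$. Let $x_1,\dots,x_n$ be i.i.d. samples from $\rho_1$ and $y_1,\dots,y_n$ i.i.d. samples from $\rho_2$ (independent of each other and of the features), and set $\phi_1=\frac1n\sum_{i=1}^n\phi(x_i)$, $\phi_2=\frac1n\sum_{i=1}^n\phi(y_i)$. Then for every $\varepsilon>0$, $$\Pr\Big[\big|\|\phi_1-\phi_2\|_2-\mathrm{MMD}(\rho_1,\rho_2)\big|\geqslant \tfrac34\varepsilon\Big]\leqslant 2e^{-nc\varepsilon^2}+\mathcal{O}\!\left(\frac{1}{\varepsilon^2}\exp\!\left(\frac{-D\varepsilon^2}{64(d+2)}\right)\right)+6e^{-\frac{n\varepsilon^2}{8}},$$ where $c>0$ is a constant.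
   Context: $\mathrm{MMD}$ is the maximum mean discrepancy with respect to the Gaussian kernel $k(x,y)=\exp(-\|x-y\|^2/(2\sigma^2))$ (same $\sigma$ as in the features), i.e. $\mathrm{MMD}^2(P,Q)=\mathbb{E}_{X,X'\sim P}[k(X,X')]+\mathbb{E}_{Y,Y'\sim Q}[k(Y,Y')]-2\,\mathbb{E}_{X\sim P,Y\sim Q}[k(X,Y)]$ with all variables independent. For a policy $\pi$ in an MDP with discount $\gamma\in(0,1)$, its occupancy measure is $\rho^\pi(\mathbf{s},\mathbf{a})=(1-\gamma)\sum_{t=0}^\infty\gamma^t P(S_t=\mathbf{s},A_t=\mathbf{a}\mid\pi)$. The probability is over both the random features and the samples. *)

(* Defs.v *)
From HB Require Import structures.
From mathcomp Require Import all_boot all_order all_algebra.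
From mathcomp Require Import all_classical all_reals all_analysis.
Set Implicit Arguments.
Unset Strict Implicit.
Unset Printing Implicit Defensive.
Import Order.TTheory GRing.Theory Num.Theory.
Local Open Scope classical_set_scope.
Local Open Scope ring_scope.

(* Vectors of R^d are represented as d.-tuple R, whose canonical
   sigma-algebra (from mathcomp-analysis) is the product sigma-algebra
   generated by the coordinate projections (= Borel sigma-algebra of R^d). *)

Section defs.
Context {R : realType}.

Definition dotv (d : nat) (u v : d.-tuple R) : R :=
  \sum_(j < d) tnth u j * tnth v j.

Definition sqdist (d : nat) (x y : d.-tuple R) : R :=
  \sum_(j < d) (tnth x j - tnth y j) ^+ 2.

Definition gauss_kernel (sigma : R) (d : nat) (x y : d.-tuple R) : R :=
  expR (- sqdist x y / (2 * sigma ^+ 2)).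

Definition kernel_mean (sigma : R) (d : nat)
    (mu nu : probability (d.-tuple R) R) : \bar R :=
  (\int[mu]_x (\int[nu]_y (gauss_kernel sigma x y)%:E))%E.

Definition MMD2 (sigma : R) (d : nat) (mu nu : probability (d.-tuple R) R) : R :=
  fine (kernel_mean sigma mu mu + kernel_mean sigma nu nu
        - 2%:E * kernel_mean sigma mu nu)%E.

Definition MMD (sigma : R) (d : nat) (mu nu : probability (d.-tuple R) R) : R :=
  Num.sqrt (MMD2 sigma mu nu).

Definition l2norm (D : nat) (v : 'I_D -> R) : R :=
  Num.sqrt (\sum_(k < D) v k ^+ 2).

Definition rff (d D : nat) (w : 'I_D -> d.-tuple R) (b : 'I_D -> R)
    (x : d.-tuple R) (k : 'I_D) : R :=
  Num.sqrt (2 / D%:R) * cos (dotv (w k) x + b k).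

Definition mean_feature (d D n : nat) (w : 'I_D -> d.-tuple R) (b : 'I_D -> R)
    (xs : 'I_n -> d.-tuple R) (k : 'I_D) : R :=
  n%:R^-1 * \sum_(i < n) rff w b (xs i) k.

End defs.

Section prob_defs.
Context {R : realType} {dT : measure_display} {T : measurableType dT}.

Definition preimg_sets {d' : measure_display} {T' : measurableType d'}
    (f : T -> T') : set (set T) :=
  [set f @^-1` A | A in [set A : set T' | measurable A]].

Definition mutually_independent (P : probability T R) (I : finType)
    (E : I -> set (set T)) : Prop :=
  forall (J : {set I}) (A : I -> set T),
    (forall i, i \in J -> E i (A i)) ->
    P (\bigcap_(i in [set i | i \in J]) A i) = (\prod_(i in J) P (A i))%E.

Definition has_law {d' : measure_display} {T' : measurableType d'}
    (P : probability T R) (X : T -> T') (mu : set T' -> \bar R) : Prop :=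
  measurable_fun setT X /\
  forall A : set T', measurable A -> P (X @^-1` A) = mu A.

End prob_defs.

(* index set of all the random quantities of the experiment:
   coordinates W k j of the frequency vectors, phases b_k,
   samples x_i and samples y_i *)
Definition rff_index (d D n : nat) : finType :=
  (('I_D * 'I_d) + ('I_D + ('I_n + 'I_n)))%type.

Definition rff_events {R : realType} {dT : measure_display} {T : measurableType dT}
    (d D n : nat) (W : 'I_D -> 'I_d -> T -> R) (B : 'I_D -> T -> R)
    (X Y : 'I_n -> T -> d.-tuple R) (i : rff_index d D n) : set (set T) :=
  match i with
  | inl (k, j) => preimg_sets (W k j)
  | inr (inl k) => preimg_sets (B k)
  | inr (inr (inl i)) => preimg_sets (X i)
  | inr (inr (inr i)) => preimg_sets (Y i)
  end.

Lemma twopi_gt0 {R : realType} : (0 : R) < pi *+ 2.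
Proof. by rewrite pmulrn_rgt0 // pi_gt0. Qed.

Definition unif_0_2pi {R : realType} := uniform_prob (@twopi_gt0 R).

(* Main.v *)
(* The samples are handled conditionally on the features.  Write c_k(rho) for the
   mean of cos(w_k.x + b_k) over x ~ rho, m_k = sqrt(2/D) (c_k(rho1) - c_k(rho2)) and
   phi_1 - phi_2 = m + S/n, where S is a sum of 2n terms that are centered given
   the features.

   Features: |m|^2 is the mean of the i.i.d. variables 2 (c_k(rho1) - c_k(rho2))^2,
   which lie in [0, 8] and have expectation MMD^2, because
   E 2 cos(w.x + b) cos(w.y + b) = k(x, y).  The chord bound of exp on [0, 8] gives
   E exp(theta D |m|^2 / 8) <= exp(D MMD^2 (e^theta - 1) / 8), a Poisson type bound
   whose optimization controls |m| - MMD itself (no square root is lost):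
   P(| |m| - MMD | >= s) <= 2 exp(- D s^2 / 32).

   Samples: exp(lam sqrt(alpha^2 + |S|^2)) is almost a supermartingale.  By
   concavity of the square root, adding a term e to v multiplies it by at most
   exp(lam (<v, e> / q + 4 / alpha)) with q = sqrt(alpha^2 + |v|^2), and <v, e> / q
   is bounded and centered.  This yields a bound on |S|/n free of the dimension D.

   The two deviations are taken with thresholds eps/2 and eps/4; for eps >= 4 the
   event is empty, so that the factor 2 is absorbed in 32 / eps^2. *)

Require Import Defs.
From HB Require Import structures.
From mathcomp Require Import all_boot all_order all_algebra.
From mathcomp Require Import all_classical all_reals all_analysis.
From mathcomp Require Import measurable_realfun ring lra.
Set Implicit Arguments.
Unset Strict Implicit.
Unset Printing Implicit Defensive.
Import Order.TTheory GRing.Theory Num.Theory.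
Import numFieldNormedType.Exports.
Local Open Scope classical_set_scope.
Local Open Scope ring_scope.

(** * Expectations of bounded measurable functions *)

Section bounded_measurable.
Context {R : realType} {d : measure_display} {T : measurableType d}.
Implicit Types f g : T -> R.

(** Such functions are integrable for every probability measure and stable under all the operations
    needed. The sigma-algebra is that of [T]; taken over a smaller one, [bmf] also records on which
    variables a function depends. *)
Definition bmf f := measurable_fun setT f /\ exists M : R, forall t, `|f t| <= M.

Lemma bmf_cst (c : R) : bmf (fun=> c).
Proof. by split; [exact: measurable_cst | exists `|c|]. Qed.

Lemma bmfD f g : bmf f -> bmf g -> bmf (fun t => f t + g t).
Proof.
move=> [mf [M fM]] [mg [N gN]]; split; first exact: measurable_funD.
by exists (M + N) => t; rewrite (le_trans (ler_normD _ _))// lerD.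
Qed.

Lemma bmfM f g : bmf f -> bmf g -> bmf (fun t => f t * g t).
Proof.
move=> [mf [M fM]] [mg [N gN]]; split; first exact: measurable_funM.
by exists (M * N) => t; rewrite normrM ler_pM.
Qed.

Lemma bmfZ (c : R) f : bmf f -> bmf (fun t => c * f t).
Proof. by apply: bmfM; exact: bmf_cst. Qed.

Lemma bmfN f : bmf f -> bmf (fun t => - f t).
Proof.
by move=> /(bmfZ (-1)); under eq_fun do rewrite mulN1r.
Qed.

Lemma bmfB f g : bmf f -> bmf g -> bmf (fun t => f t - g t).
Proof. by move=> bf bg; apply: bmfD => //; exact: bmfN. Qed.

Lemma bmfX n f : bmf f -> bmf (fun t => f t ^+ n).
Proof.
move=> bf; elim: n => [|n IH]; first exact: bmf_cst.
by under eq_fun do rewrite exprS; exact: bmfM.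
Qed.

Lemma bmf_sum (I : Type) (s : seq I) (f : I -> T -> R) :
  (forall i, bmf (f i)) -> bmf (fun t => \sum_(i <- s) f i t).
Proof.
move=> bf; elim: s => [|i s IH].
  by under eq_fun do rewrite big_nil; exact: bmf_cst.
by under eq_fun do rewrite big_cons; exact: bmfD.
Qed.

Lemma bmf_sum_in (I : eqType) (s : seq I) (f : I -> T -> R) :
  (forall i, i \in s -> bmf (f i)) -> bmf (fun t => \sum_(i <- s) f i t).
Proof.
elim: s => [|i s IH] bf.
  by under eq_fun do rewrite big_nil; exact: bmf_cst.
under eq_fun do rewrite big_cons.
apply: bmfD; first by apply: bf; rewrite mem_head.
by apply: IH => j js; apply: bf; rewrite in_cons js orbT.
Qed.

Lemma bmf_nondecreasing (g : R -> R) f : measurable_fun setT g ->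
  {homo g : x y / x <= y} -> bmf f -> bmf (fun t => g (f t)).
Proof.
move=> mg ndg [mf [M fM]]; split; first exact: measurableT_comp.
exists (`|g M| + `|g (- M)|) => t.
have := fM t; rewrite ler_norml => /andP[/ndg lo /ndg hi].
have := ler_norm (g M); have := ler_norm (- g (- M)); rewrite normrN => *.
by rewrite ler_norml; apply/andP; split; have := normr_ge0 (g M);
  have := normr_ge0 (g (- M)); lra.
Qed.

Lemma bmf_expR f : bmf f -> bmf (fun t => expR (f t)).
Proof.
by apply: bmf_nondecreasing => [|x y]; [exact: measurable_expR|rewrite ler_expR].
Qed.

Lemma bmf_sqrt f : bmf f -> bmf (fun t => Num.sqrt (f t)).
Proof.
apply: bmf_nondecreasing => [|x y]; last exact: ler_wsqrtr.
by apply: continuous_measurable_fun; exact: sqrt_continuous.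
Qed.

Lemma bmf_cos f : measurable_fun setT f -> bmf (fun t => cos (f t)).
Proof.
move=> mf; split; last by exists 1 => t; exact: cos_max.
by apply: measurableT_comp mf; apply: continuous_measurable_fun; exact: continuous_cos.
Qed.

Lemma bmf_sin f : measurable_fun setT f -> bmf (fun t => sin (f t)).
Proof.
move=> mf; split; last by exists 1 => t; exact: sin_max.
by apply: measurableT_comp mf; apply: continuous_measurable_fun; exact: continuous_sin.
Qed.

(** The conclusion is [bmf] over [T'] in unfolded form, because inside this section [bmf] is tied to
    [T]. *)
Lemma bmf_comp d' (T' : measurableType d') (V : T' -> T) f :
  measurable_fun setT V -> bmf f ->
  measurable_fun setT (fun t => f (V t)) /\ exists M, forall t, `|f (V t)| <= M.
Proof.
move=> mV [mf [M fM]]; split; first exact: measurableT_comp.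
by exists M.
Qed.

End bounded_measurable.

Section expectation.
Context {R : realType} {d : measure_display} {T : measurableType d}.
Variable P : probability T R.
Implicit Types f g : T -> R.

Lemma bmf_integrable f : bmf f -> P.-integrable setT (EFin \o f).
Proof.
move=> [mf [M fM]]; apply: measurable_bounded_integrable => //.
  by rewrite ltey_eq fin_num_measure.
by exists M; split; [exact: num_real|move=> N MN t _; exact: le_trans (fM t) (ltW MN)].
Qed.

Lemma EFin_expect f : bmf f -> (\int[P]_t f t)%:E = (\int[P]_t (f t)%:E)%E.
Proof. by move=> bf; rewrite fineK//; exact/integrable_fin_num/bmf_integrable. Qed.

Lemma expect_cst (c : R) : \int[P]_t c = c.
Proof. by rewrite Rintegral_cst//= probability_setT mulr1. Qed.

Lemma expectD f g : bmf f -> bmf g ->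
  \int[P]_t (f t + g t) = \int[P]_t f t + \int[P]_t g t.
Proof. by move=> *; rewrite RintegralD//; exact: bmf_integrable. Qed.

Lemma expectB f g : bmf f -> bmf g ->
  \int[P]_t (f t - g t) = \int[P]_t f t - \int[P]_t g t.
Proof. by move=> *; rewrite RintegralB//; exact: bmf_integrable. Qed.

Lemma expectZl (c : R) f : bmf f -> \int[P]_t (c * f t) = c * \int[P]_t f t.
Proof. by move=> *; rewrite RintegralZl//; exact: bmf_integrable. Qed.

Lemma expectZr (c : R) f : bmf f -> \int[P]_t (f t * c) = (\int[P]_t f t) * c.
Proof. by move=> *; rewrite RintegralZr//; exact: bmf_integrable. Qed.

Lemma expect_sum (I : Type) (s : seq I) (f : I -> T -> R) :
  (forall i, bmf (f i)) ->
  \int[P]_t (\sum_(i <- s) f i t) = \sum_(i <- s) \int[P]_t f i t.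
Proof.
move=> bf; elim: s => [|i s IH].
  rewrite big_nil -[RHS](expect_cst 0).
  by apply: eq_Rintegral => t _; rewrite big_nil.
rewrite big_cons -IH -expectD//; last exact: bmf_sum.
by apply: eq_Rintegral => t _; rewrite big_cons.
Qed.

Lemma expect_le f g : bmf f -> bmf g -> (forall t, f t <= g t) ->
  \int[P]_t f t <= \int[P]_t g t.
Proof. by move=> *; apply: le_Rintegral => //; exact: bmf_integrable. Qed.

Lemma expect_ge0 f : (forall t, 0 <= f t) -> 0 <= \int[P]_t f t.
Proof. by move=> f0; exact: Rintegral_ge0. Qed.

Lemma expect_norm_le (M : R) f : bmf f -> (forall t, `|f t| <= M) ->
  `|\int[P]_t f t| <= M.
Proof.
move=> bf fM; rewrite (le_trans (le_normr_Rintegral _ _))//.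
  exact: bmf_integrable.
rewrite -[leRHS]expect_cst; apply: expect_le => //; last exact: bmf_cst.
have [mf [N fN]] := bf; split; first exact: measurableT_comp.
by exists N => t; rewrite normr_id.
Qed.

(** Markov's inequality, with [f] dominating the indicator of [A]. The tail bounds are all given as
    such an [f], so that a union bound amounts to adding functions. *)
Lemma prob_le_expect (A : set T) f : measurable A -> bmf f ->
  (forall t, 0 <= f t) -> (forall t, A t -> 1 <= f t) ->
  (P A <= (\int[P]_t f t)%:E)%E.
Proof.
move=> mA bf f0 f1; rewrite EFin_expect// -(setIT A) -integral_indic//.
have [mf _] := bf.
apply: ge0_le_integral => //.
- by apply/measurable_EFinP; exact: measurable_indic.
- exact/measurable_EFinP.
- move=> t _; rewrite lee_fin indicE; case: (boolP (t \in A)) => // /set_mem.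
  exact: f1.
Qed.

End expectation.

(** * Fubini for bounded measurable functions *)

Section Fubini.
Context {R : realType} {d1 d2 : measure_display}.
Context {T1 : measurableType d1} {T2 : measurableType d2}.
Variables (P : probability T1 R) (Q : probability T2 R).
Variable f : T1 * T2 -> R.
Hypothesis bf : bmf f.

Lemma bmf_section1 x : bmf (fun y => f (x, y)).
Proof.
have [mf [M fM]] := bf; split; last by exists M.
exact: measurable_fun_pair2.
Qed.

Lemma bmf_section2 y : bmf (fun x => f (x, y)).
Proof.
have [mf [M fM]] := bf; split; last by exists M.
exact: measurable_fun_pair1.
Qed.

Lemma bmf_fubini : bmf (fun x => \int[Q]_y f (x, y)).
Proof.
split; last first.
  have [mf [M fM]] := bf; exists M => x.
  by apply: expect_norm_le => //; exact: bmf_section1.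
apply/measurable_EFinP.
rewrite [X in measurable_fun _ X](_ : _ = fun x => (\int[Q]_y (f (x, y))%:E)%E).
  (* Measurability of the partial integral is derived from integrability on a product space. A Dirac
     mass serves as the first factor, so that only [Q] enters the lemma. *)
  pose P0 : probability T1 R := \d_(point : T1).
  exact: (measurable_fubini_F (bmf_integrable (P0 \x Q)%E bf)).
by apply/funext => x /=; rewrite EFin_expect//; exact: bmf_section1.
Qed.

Lemma bmf_fubini2 : bmf (fun y => \int[P]_x f (x, y)).
Proof.
split; last first.
  have [mf [M fM]] := bf; exists M => x.
  by apply: expect_norm_le => //; exact: bmf_section2.
apply/measurable_EFinP.
rewrite [X in measurable_fun _ X](_ : _ = fun y => (\int[P]_x (f (x, y))%:E)%E).
  pose Q0 : probability T2 R := \d_(point : T2).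
  exact: (measurable_fubini_G (bmf_integrable (P \x Q0)%E bf)).
by apply/funext => y /=; rewrite EFin_expect//; exact: bmf_section2.
Qed.

Let intf : (P \x Q)%E.-integrable setT (EFin \o f) :=
  bmf_integrable (P \x Q)%E bf.

Lemma expect_prod : \int[(P \x Q)%E]_z f z = \int[P]_x \int[Q]_y f (x, y).
Proof.
apply: EFin_inj; rewrite (EFin_expect P bmf_fubini) (@EFin_expect _ _ _ (P \x Q)%E)//.
rewrite -(integral12_prod_meas1 intf); apply: eq_integral => x _.
by rewrite EFin_expect//; exact: bmf_section1.
Qed.

Lemma expect_fubini :
  \int[P]_x \int[Q]_y f (x, y) = \int[Q]_y \int[P]_x f (x, y).
Proof.
apply: EFin_inj; rewrite (EFin_expect P bmf_fubini) (EFin_expect Q bmf_fubini2).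
transitivity (\int[P]_x \int[Q]_y (f (x, y))%:E)%E.
  by apply: eq_integral => x _; rewrite EFin_expect//; exact: bmf_section1.
rewrite (Fubini intf); apply: eq_integral => y _.
by rewrite EFin_expect//; exact: bmf_section2.
Qed.

End Fubini.

Lemma expect_comp {R : realType} {d d' : measure_display}
    {T : measurableType d} {T' : measurableType d'}
    (P : probability T R) (Q : probability T' R) (V : T -> T') (f : T' -> R) :
  measurable_fun setT V ->
  (forall A, measurable A -> P (V @^-1` A) = Q A) -> bmf f ->
  \int[P]_t f (V t) = \int[Q]_x f x.
Proof.
move=> mV PQ bf; have [mf [M fM]] := bf.
pose V' : {mfun T >-> T'} := HB.pack V (isMeasurableFun.Build _ _ _ _ V mV).
congr fine; transitivity (\int[distribution P V']_x (f x)%:E)%E.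
  rewrite integral_distribution//; first exact/measurable_EFinP.
  by apply: bmf_integrable; split; [exact: measurableT_comp|exists M].
by apply: eq_measure_integral => A mA _; exact: PQ.
Qed.

(** * Independence of one variable from all the others *)

Section independence.
Context {R : realType} {dT : measure_display} {T : measurableType dT}.
Variables (P : probability T R) (I : finType) (E : I -> set (set T)).
Hypothesis ET : forall i, E i setT.
Hypothesis EI : forall i, setI_closed (E i).
Hypothesis Em : forall i, E i `<=` measurable.
Hypothesis indE : mutually_independent P E.

(* A pi-system generating the sigma-algebra of all the variables but the i-th one. *)
Definition others (i : I) : set (set T) :=
  [set A | exists F : I -> set T,
     (forall j, E j (F j)) /\ A = \bigcap_(j in [set j | j != i]) F j].

Lemma others_measurable i : others i `<=` measurable.
Proof.
move=> _ [F [EF ->]]; apply: fin_bigcap_measurable => [|j _]; last by apply: Em; exact: EF.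
exact: (@finite_finpred _ _ (fun j => j != i)).
Qed.

Lemma others_setI i : setI_closed (others i).
Proof.
move=> _ _ [F [EF ->]] [G [EG ->]]; exists (fun j => F j `&` G j); split.
  by move=> j; exact: EI.
by rewrite bigcapI.
Qed.

Lemma others_setT i : others i setT.
Proof. by exists (fun=> setT); split => //; rewrite bigcapT. Qed.

Lemma sub_others i j : j != i -> E j `<=` others i.
Proof.
move=> ji A EA; exists (fun k => if k == j then A else setT); split.
  by move=> k; case: eqP => [->|_].
apply/seteqP; split=> t.
  by move=> At k /= _; case: eqP.
by move=> /(_ j ji); rewrite eqxx.
Qed.

(** The finite measures P(. [&] B) and P(B) P(.) agree on the pi-system [others i], hence on the
    sigma-algebra that it generates. *)
Lemma others_indep i A B : <<s others i >> A -> E i B ->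
  P (A `&` B) = (P A * P B)%E.
Proof.
move=> sA EB; have mB := Em EB.
have PB0 : 0 <= fine (P B) by exact: fine_ge0.
have PBE : (fine (P B))%:E = P B by rewrite fineK// fin_num_measure.
suff : mrestr P mB A = mscale (NngNum PB0) P A.
  by rewrite /mrestr /mscale /= PBE muleC.
apply: (g_sigma_algebra_measure_unique (others i) _ (fun=> setT)) => //=.
- exact: others_measurable.
- by move=> _; exact: others_setT.
- by rewrite bigcup_const.
- exact: others_setI.
- move=> _ [F [EF ->]]; rewrite /mscale /= PBE.
  (* Independence is used twice: for all indices with [F'], and for all indices but [i] with [F].
     The first product is the second one times P(B). *)
  pose F' j := if j == i then B else F j.
  have EF' j : E j (F' j) by rewrite /F'; case: eqP => [->|].
  have := indE (J := [set: I]%SET) (fun j _ => EF' j).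
  have := indE (J := [set~ i]%SET) (fun j _ => EF j).
  rewrite (_ : [set j | j \in [set~ i]%SET] = [set j | j != i]); last first.
    by apply/seteqP; split => j /=; rewrite finset.in_setC1.
  move=> ->.
  rewrite (_ : [set j | j \in [set: I]%SET] = [set: I]); last first.
    by apply/seteqP; split => j //=; rewrite finset.in_setT.
  rewrite (bigD1 i)//= /F' eqxx => H.
  transitivity (P (\bigcap_(j in [set: I]) (if j == i then B else F j))).
    congr (P _); apply/seteqP; split => t.
      by move=> [h Bt] j _; case: eqP => // /eqP ji; exact: h.
    move=> h; split; last by have := h i Logic.I; rewrite eqxx.
    by move=> j /= ji; have := h j Logic.I; rewrite (negbTE ji).
  rewrite H; congr (_ * _)%E; apply: eq_big => j; first by rewrite !inE.
  by move=> /andP[_ /negbTE ->].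
- by move=> _; rewrite /mrestr ltey_eq fin_num_measure//; exact: measurableI.
Qed.

(** * Integrating out one variable with the others frozen *)

Section one_variable.
Variables (i : I) (d' : measure_display) (T' : measurableType d').
Variables (X : T -> T') (rho : probability T' R).
Hypothesis lawX : has_law P X rho.
Hypothesis EX : E i = preimg_sets X.

Local Notation Ti := (g_sigma_algebraType (others i)).

Let idTi : T -> Ti := id.

Let measurable_idTi : measurable_fun setT idTi.
Proof.
move=> _ A sA; rewrite setTI preimage_id.
by apply: (smallest_sub (@sigma_algebra_measurable _ T) _ sA); exact: others_measurable.
Qed.

Let PTi : probability Ti R :=
  distribution P (HB.pack idTi (isMeasurableFun.Build _ _ _ _ idTi measurable_idTi)
    : {mfun T >-> Ti}).

(** By [others_indep] on rectangles, the joint law of the identity into [Ti] and of [X] is a product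
    measure, and Fubini applies. This replaces conditional expectation given all the other
    variables. *)
Lemma expect_indep (f : Ti * T' -> R) : bmf f ->
  \int[P]_t f (t, X t) = \int[P]_t \int[rho]_x f (t, x).
Proof.
move=> bf; have [mX PX] := lawX.
have mV : measurable_fun setT (fun t => (idTi t, X t)).
  exact: measurable_fun_pair.
transitivity (\int[(PTi \x rho)%E]_z f z).
  apply: (@expect_comp _ _ _ T (Ti * T')%type P (PTi \x rho)%E _ _ mV) => // A mA.
  pose V' : {mfun T >-> (Ti * T')%type} :=
    HB.pack (fun t => (idTi t, X t)) (isMeasurableFun.Build _ _ _ _ _ mV).
  apply/esym; transitivity (distribution P V' A); last by [].
  apply: product_measure_unique => // C B mC mB.
  have EB : E i (X @^-1` B) by rewrite EX; exists B.
  by have := others_indep mC EB; rewrite PX.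
rewrite expect_prod//; apply/esym.
apply: (@expect_comp _ _ _ _ _ _ PTi idTi (fun t => \int[rho]_x f (t, x))) => //.
exact: bmf_fubini.
Qed.

End one_variable.

Lemma bmf_others i (f : g_sigma_algebraType (others i) -> R) :
  bmf f -> bmf (f : T -> R).
Proof.
move=> [mf [M fM]]; split; last by exists M.
move=> _ A mA; have := mf measurableT A mA; rewrite !setTI => sA.
by apply: (smallest_sub (@sigma_algebra_measurable _ T) _ sA); exact: others_measurable.
Qed.

End independence.

(** * Characteristic functions of the normal and uniform laws *)

(** The fundamental theorem of calculus on growing symmetric intervals gives the boundary terms;
    dominated convergence, with |h| as the dominating function, passes to the whole line. *)
Lemma integral_derivative_eq0 {R : realType} (F h : R -> R) :
  (forall x, is_derive x (1 : R) F (h x)) -> continuous h ->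
  lebesgue_measure.-integrable setT (fun x : measurableTypeR R => (h x)%:E) ->
  F n.+1%:R - F (- n.+1%:R) @[n --> \oo] --> 0 ->
  \int[lebesgue_measure]_x h x = 0.
Proof.
move=> dF ch ih F0; pose mu := @lebesgue_measure R.
have cF : continuous F.
  move=> x; apply/differentiable_continuous/derivable1_diffP.
  by have [] := dF x.
(* The radius n + 1 keeps the interval nondegenerate for n = 0. *)
pose I n : set R := `[- n.+1%:R, n.+1%:R]%classic.
have mh : measurable_fun setT h by exact: continuous_measurable_fun.
have mf_ n : measurable_fun setT ((EFin \o h) \_ (I n)).
  apply/(measurable_restrictT _ _).1 => //; first exact: measurable_itv.
  by apply/measurable_EFinP; exact: measurable_funTS.
have cvg_f x : (fun n => ((EFin \o h) \_ (I n)) x) @ \oo --> (EFin \o h) x.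
  apply: cvg_near_cst; near=> n; rewrite patchE mem_set//= /I/= in_itv/= -ler_norml.
  rewrite (@le_trans _ _ n%:R)// ?ler_nat//.
  by near: n; exact: nbhs_infty_ger.
have [||||| _ _ ] := @dominated_convergence _ _ _ mu setT measurableT
  (fun n => (EFin \o h) \_ (I n)) (EFin \o h) (abse \o (EFin \o h)).
- exact: mf_.
- exact/measurable_EFinP.
- by apply: aeW => x _; exact: cvg_f.
- exact: integrable_abse.
- apply: aeW => x n _; rewrite patchE /=; case: ifP => // _.
  by rewrite abse0 lee_fin normr_ge0.
have -> : [sequence (\int[mu]_x ((EFin \o h) \_ (I n)) x)%E]_n =
    (fun n => (F n.+1%:R - F (- n.+1%:R))%:E).
  apply/funext => n; rewrite /= -integral_mkcond EFinB.
  apply: continuous_FTC2 => //.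
  - by rewrite -subr_gt0 opprK addr_gt0.
  - exact: continuous_subspaceT.
  - split.
    + by move=> x _; have [] := dF x.
    + by apply: cvg_at_right_filter; exact: cF.
    + by apply: cvg_at_left_filter; exact: cF.
  - by move=> x _; rewrite derive1E; have [_ ->] := dF x.
move=> H; have {}F0 : (F n.+1%:R - F (- n.+1%:R))%:E @[n --> \oo] --> 0%:E.
  by apply: cvg_EFin; [exact: nearW|exact: F0].
by rewrite /Rintegral (cvg_unique (@ereal_hausdorff R) H F0).
Unshelve. all: end_near. Qed.

Section normal_expectation.
Context {R : realType}.
Variable s : R.
Hypothesis s_gt0 : 0 < s.
Local Notation mu := (@lebesgue_measure R).
Local Notation p := (normal_pdf 0 s).

Lemma expect_normal (f : measurableTypeR R -> R) : bmf f ->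
  \int[normal_prob 0 s]_x f x = \int[mu]_x (f x * p x).
Proof.
move=> bf; have [mf _] := bf.
have intf := bmf_integrable (normal_prob 0 s) bf.
congr fine; rewrite -(Radon_Nikodym_change_of_variables (normal_prob_dominates 0 s))//=.
under [RHS]eq_integral do rewrite EFinM.
apply: ae_eq_integral => //.
- apply: emeasurable_funM => //; first exact/measurable_EFinP.
  apply: (measurable_int mu).
  by apply: Radon_Nikodym_integrable; exact: normal_prob_dominates.
- apply: emeasurable_funM; apply/measurable_EFinP => //.
  exact: measurable_normal_pdf.
(* The Radon-Nikodym derivative and the Gaussian density have the same integral over every
   measurable set, so they agree almost everywhere. *)
- apply: ae_eqe_mul2l => /=.
  rewrite Radon_NikodymE//=; first exact: normal_prob_dominates.
  move=> abmu.
  case: cid => /= h [h1 h2 h3].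
  apply: integral_ae_eq => //=.
  + by apply/measurable_EFinP; exact: measurable_normal_pdf.
  + by move=> E E01 mE; rewrite -h3.
Qed.

Lemma normal_pdf0E x : p x = normal_peak s * expR (- (x ^+ 2 / (s ^+ 2 *+ 2))).
Proof. by rewrite normal_pdfE ?gt_eqF// /normal_fun subr0 mulNr. Qed.

Lemma is_derive_normal_pdf x : is_derive x (1 : R) p (- (x / s ^+ 2 * p x)).
Proof.
have s20 : s ^+ 2 != 0 by rewrite sqrf_eq0 gt_eqF.
rewrite (_ : p = fun x => normal_peak s * expR (- (x ^+ 2 / (s ^+ 2 *+ 2)))); last first.
  by apply/funext => y; rewrite normal_pdf0E.
apply: is_derive_eq.
rewrite /GRing.scale /=. by field; rewrite gt_eqF.
Qed.


(** Since 2z <= 1 + z^2 <= 1 + (exp(z^2) - 1) + z^2 - z^2 for z = |x| / (2s), one has |x| <= s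
    exp(x^2 / (4 s^2)). The product is thus dominated by a multiple of the normal density of
    variance 2 s^2. *)
Lemma integrable_id_normal_pdf :
  mu.-integrable setT (fun x : measurableTypeR R => (`|x| * p x)%:E).
Proof.
have q0 : 0 < Num.sqrt 2 * s by rewrite mulr_gt0// sqrtr_gt0.
pose q := normal_pdf 0 (Num.sqrt 2 * s).
have np0 : 0 < normal_peak (Num.sqrt 2 * s) by rewrite normal_peak_gt0// gt_eqF.
have iq : mu.-integrable setT (fun x : measurableTypeR R =>
    ((s * normal_peak s / normal_peak (Num.sqrt 2 * s)) * q x)%:E).
  under eq_fun do rewrite EFinM.
  by apply: integrableZl => //; exact: integrable_normal_pdf.
apply: le_integrable iq => //.
  apply/measurable_EFinP; apply: measurable_funM; last exact: measurable_normal_pdf.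
  exact: normr_measurable.
move=> x _ /=; rewrite lee_fin ger0_norm; last by rewrite mulr_ge0// normal_pdf_ge0.
rewrite (le_trans _ (ler_norm _))// normal_pdf0E /q normal_pdfE ?gt_eqF//.
rewrite /normal_fun subr0.
set y := x ^+ 2 / (s ^+ 2 *+ 2).
have sy : `|x| <= s * expR (y / 2).
  have y0 : 0 <= y by rewrite divr_ge0 ?mulrn_wge0 ?sqr_ge0.
  apply: le_trans (ler_wpM2l (ltW s_gt0) (expR_ge1Dx (y / 2))).
  have -> : y / 2 = (`|x| / s / 2) ^+ 2.
    by rewrite /y -[x ^+ 2]real_normK ?num_real//; field; rewrite gt_eqF.
  set z := `|x| / s / 2.
  have -> : `|x| = s * (2 * z) by rewrite /z; field; rewrite gt_eqF.
  rewrite ler_pM2l//; have := sqr_ge0 (z - 1); lra.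
have -> : - x ^+ 2 / ((Num.sqrt 2 * s) ^+ 2 *+ 2) = - y + y / 2.
  rewrite exprMn sqr_sqrtr// /y; field.
  by rewrite gt_eqF.
rewrite expRD; have := ler_wpM2l (mulr_ge0 (normal_peak_ge0 s) (expR_ge0 (- y))) sy.
rewrite mulrC => /le_trans; apply; rewrite le_eqVlt; apply/orP; left; apply/eqP.
by field; rewrite gt_eqF.
Qed.

(** From exp(-y) <= 1/y and n + 1 <= (n + 1)^2, the density is squeezed under a multiple of the
    harmonic sequence. *)
Lemma normal_pdf_cvg0 : p n.+1%:R @[n --> \oo] --> 0.
Proof.
apply: (@squeeze_cvgr _ _ _ _ (cst 0) (fun n => (normal_peak s * (s ^+ 2 *+ 2)) * harmonic n)).
- apply: nearW => n /=; rewrite normal_pdf_ge0 normal_pdf0E /=.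
  rewrite -mulrA ler_wpM2l ?normal_peak_ge0//.
  set y := (n.+1%:R) ^+ 2 / _.
  have s20 : 0 < s ^+ 2 *+ 2 by rewrite mulrn_wgt0// exprn_gt0.
  have y0 : 0 < y by rewrite divr_gt0// exprn_gt0.
  rewrite expRN -[leRHS]invrK lef_pV2 ?posrE ?expR_gt0 ?invr_gt0 ?mulr_gt0//.
  apply: le_trans (expR_ge1Dx y); rewrite invfM invrK -[leLHS]add0r lerD//.
  rewrite /y [leRHS]mulrC ler_pM2l ?invr_gt0//.
  by rewrite expr2 ler_peMl// ler1n.
- exact: cvg_cst.
- rewrite -[X in _ --> X](mulr0 (normal_peak s * (s ^+ 2 *+ 2))).
  by apply: cvgMr; exact: cvg_harmonic.
Qed.

Lemma integrable_mul_normal_pdf (f : R -> R) : measurable_fun setT f ->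
  (forall x, `|f x| <= 1) ->
  mu.-integrable setT (fun x : measurableTypeR R => (f x * p x)%:E) /\
  mu.-integrable setT (fun x : measurableTypeR R => (f x * (x * p x))%:E).
Proof.
move=> mf f1; have mp := measurable_normal_pdf 0 s.
split.
  apply: le_integrable (integrable_normal_pdf 0 s) => //.
    by apply/measurable_EFinP; exact: measurable_funM.
  by move=> x _ /=; rewrite lee_fin normrM; apply: ler_piMl.
apply: le_integrable integrable_id_normal_pdf => //.
  by apply/measurable_EFinP; apply: measurable_funM => //; exact: measurable_funM.
move=> x _ /=; rewrite lee_fin !normrM normr_id -normrM.
by apply: ler_piMl.
Qed.

(* Integral of the derivative of sin(th + u x) p(x), where p' = - x p / s^2. *)
Lemma normal_stein (th u : R) :
  \int[mu]_x (sin (th + u * x) * (x * p x)) =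
  s ^+ 2 * u * \int[mu]_x (cos (th + u * x) * p x).
Proof.
have s20 : s ^+ 2 != 0 by rewrite sqrf_eq0 gt_eqF.
have mlin : measurable_fun setT (fun x : R => th + u * x).
  apply: measurable_funD => //; exact: measurable_funM.
have [_ isin] := integrable_mul_normal_pdf (bmf_sin mlin).1 (fun x => sin_max _).
have [icos _] := integrable_mul_normal_pdf (bmf_cos mlin).1 (fun x => cos_max _).
pose h x := u * (cos (th + u * x) * p x) - (s ^+ 2)^-1 * (sin (th + u * x) * (x * p x)).
have cp : continuous p by apply: continuous_normal_pdf; rewrite gt_eqF.
have clin : continuous (fun x : R => th + u * x).
  by move=> x; apply: cvgD; [exact: cvg_cst|apply: cvgMr; exact: cvg_id].
have ccos : continuous (fun x => cos (th + u * x)).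
  by move=> x; apply: continuous_comp; [exact: clin|exact: continuous_cos].
have csin : continuous (fun x => sin (th + u * x)).
  by move=> x; apply: continuous_comp; [exact: clin|exact: continuous_sin].
have iucos : mu.-integrable setT (fun x : measurableTypeR R =>
    (u * (cos (th + u * x) * p x))%:E).
  by under eq_fun do rewrite EFinM; exact: integrableZl.
have issin : mu.-integrable setT (fun x : measurableTypeR R =>
    ((s ^+ 2)^-1 * (sin (th + u * x) * (x * p x)))%:E).
  by under eq_fun do rewrite EFinM; exact: integrableZl.
have : \int[mu]_x h x = 0.
  apply: (@integral_derivative_eq0 _ (fun x => sin (th + u * x) * p x)).
  - move=> x; have dp := is_derive_normal_pdf x.
    apply: is_derive_eq; rewrite /h /GRing.scale /=; ring.
  - move=> x; apply: cvgB; apply: cvgMr; apply: cvgM.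
    + exact: ccos.
    + exact: cp.
    + exact: csin.
    + by apply: cvgM; [exact: cvg_id|exact: cp].
  - rewrite /h; under eq_fun do rewrite EFinB.
    exact: integrableB.
  - rewrite -[X in _ --> X](subr0 0).
    have pN x : p (- x) = p x by rewrite !normal_pdf0E sqrrN.
    (* The boolean selects the sign of the end point, so one squeeze serves both ends of the
       line. *)
    have bnd (e : bool) : sin (th + u * ((-1) ^+ e * n.+1%:R)) * p n.+1%:R @[n --> \oo] --> 0.
      apply: norm_cvg0; apply: (@squeeze_cvgr _ _ _ _ (cst 0) (fun n => p n.+1%:R)).
      + apply: nearW => n /=; rewrite normr_ge0 normrM [X in _ * X]ger0_norm ?normal_pdf_ge0//=.
        by rewrite ler_piMl ?normal_pdf_ge0 ?sin_max.
      + exact: cvg_cst.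
      + exact: normal_pdf_cvg0.
    apply: cvgB.
      by have := bnd false; under eq_fun do rewrite expr0 mul1r.
    by have := bnd true; under eq_fun do rewrite expr1 mulN1r -[p _]pN.
rewrite /h RintegralB//.
rewrite !RintegralZl// => /eqP; rewrite subr_eq0 => /eqP e.
by rewrite -mulrA e mulVKf.
Qed.

(** Differentiation under the integral sign, with the integrable bound |x| p(x) uniform in the
    frequency. *)
Lemma derive_normal_cos (th u : R) :
  is_derive u (1 : R) (fun u => \int[mu]_x (cos (th + u * x) * p x))
    (- \int[mu]_x (sin (th + u * x) * (x * p x))).
Proof.
have mlin v : measurable_fun setT (fun x : R => th + v * x).
  apply: measurable_funD => //; exact: measurable_funM.
pose f v x := cos (th + v * x) * p x.
have df v x : is_derive v (1 : R) (f ^~ x) (- (sin (th + v * x) * (x * p x))).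
  by rewrite /f; apply: is_derive_eq; rewrite /GRing.scale /=; ring.
have icos v := (integrable_mul_normal_pdf (bmf_cos (mlin v)).1 (fun x => cos_max _)).1.
have isin v := (integrable_mul_normal_pdf (bmf_sin (mlin v)).1 (fun x => sin_max _)).2.
have uI : `]u - 1, u + 1[%classic u by rewrite /= in_itv/= ltrBlDr ltrDl ltr01.
have d1f v x : partial1of2 f v x = - (sin (th + v * x) * (x * p x)).
  by rewrite partial1of2E; have [_ ->] := df v x.
have hf : forall v, `]u - 1, u + 1[%classic v -> mu.-integrable setT (EFin \o f v).
  by move=> v _; exact: icos.
have hd : forall v x, `]u - 1, u + 1[%classic v -> [set: measurableTypeR R] x -> derivable (f ^~ x) v 1.
  by move=> v x _ _; have [] := df v x.
have G0 : forall x : measurableTypeR R, 0 <= `|x| * p x.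
  by move=> x; rewrite mulr_ge0// normal_pdf_ge0.
have hub : forall v x, `]u - 1, u + 1[%classic v -> [set: measurableTypeR R] x ->
    `|partial1of2 f v x| <= `|x| * p x.
  move=> v x _ _; rewrite d1f normrN !normrM [`|p x|]ger0_norm ?normal_pdf_ge0//.
  by rewrite ler_piMl ?sin_max// mulr_ge0// normal_pdf_ge0.
apply: DeriveDef.
  exact: (derivable_under_integral measurableT uI hf hd G0 integrable_id_normal_pdf hub).
rewrite -derive1E (differentiation_under_integral measurableT uI hf hd G0 integrable_id_normal_pdf hub).
rewrite -mulN1r -RintegralZl//; last exact: isin.
by apply: eq_Rintegral => x _; rewrite mulN1r; exact: d1f.
Qed.

(* Both sides solve F' = - s^2 u F in u; the phase th avoids a separate sine version. *)
Lemma expect_normal_cos (th u : R) :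
  \int[normal_prob 0 s]_x cos (th + u * x) =
  cos th * expR (- (u ^+ 2 * s ^+ 2 / 2)).
Proof.
have mlin v : measurable_fun setT (fun x : R => th + v * x).
  apply: measurable_funD => //; exact: measurable_funM.
rewrite expect_normal; last first.
  exact: (bmf_cos (mlin u)).
pose F v := \int[mu]_x (cos (th + v * x) * p x).
pose G v := F v * expR (v ^+ 2 * (s ^+ 2 / 2)).
have dG v : is_derive v (1 : R) G 0.
  have dF := derive_normal_cos th v.
  apply: is_derive_eq; rewrite normal_stein /GRing.scale /= -/(F v); by field.
have E := is_derive_0_is_cst u 0 dG.
rewrite /G expr0n /= mul0r expR0 mulr1 in E.
have -> : cos th = F 0.
  rewrite /F; under eq_Rintegral do rewrite mul0r addr0.
  have ip := integrable_normal_pdf 0 s.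
  by rewrite RintegralZl// /Rintegral integral_normal_pdf mulr1.
by rewrite -E -mulrA expRN mulfK// gt_eqF// expR_gt0.
Qed.

End normal_expectation.

Lemma expect_uniform_cos {R : realType} (th : R) :
  \int[unif_0_2pi]_b cos (th + 2 * b) = 0.
Proof.
have mlin : measurable_fun setT (fun x : R => th + 2 * x).
  by apply: measurable_funD => //; exact: measurable_funM.
have bcos : bmf (fun b : measurableTypeR R => cos (th + 2 * b)) := bmf_cos mlin.
have clin : continuous (fun x : R => th + 2 * x).
  by move=> x; apply: cvgD; [exact: cvg_cst|apply: cvgMr; exact: cvg_id].
(* Adding 1 makes the integrand nonnegative, as [integral_uniform] requires. The antiderivative of
   the cosine term then cancels over two full periods. *)
suff : \int[unif_0_2pi]_b (1 + cos (th + 2 * b)) = 1.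
  rewrite expectD ?expect_cst//; last exact: bmf_cst.
  by move=> /eqP; rewrite -[X in _ == X]addr0 => /eqP /addrI.
rewrite /Rintegral integral_uniform; last 2 first.
- by apply/measurable_EFinP; exact: (bmfD (bmf_cst 1) bcos).1.
- by move=> x; rewrite lee_fin -lerBlDl sub0r cos_geN1.
rewrite (@continuous_FTC2 _ _ (fun b => b + sin (th + 2 * b) / 2) 0 (pi *+ 2)).
- rewrite mulr0 addr0 add0r subr0.
  have -> : sin (th + 2 * (pi *+ 2)) = sin th.
    have -> : th + 2 * (pi *+ 2) = th + pi *+ 2 + pi *+ 2 :> R by ring.
    by rewrite !sinD2pi.
  rewrite -EFinD -EFinM /= addrK mulVf// gt_eqF//; exact: twopi_gt0.
- exact: twopi_gt0.
- apply: continuous_subspaceT => x; apply: cvgD; first exact: cvg_cst.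
  by apply: continuous_comp; [exact: clin|exact: continuous_cos].
- have dF x : is_derive x (1 : R) (fun b : R => b + sin (th + 2 * b) / 2)
      (1 + cos (th + 2 * x)).
    by apply: is_derive_eq; rewrite /GRing.scale /=; field.
  have cF : continuous (fun b : R => b + sin (th + 2 * b) / 2).
    move=> x; apply/differentiable_continuous/derivable1_diffP.
    by have [] := dF x.
  split.
  + by move=> x _; have [] := dF x.
  + by apply: cvg_at_right_filter; exact: cF.
  + by apply: cvg_at_left_filter; exact: cF.
- move=> x _; have dF : is_derive x (1 : R) (fun b : R => b + sin (th + 2 * b) / 2)
      (1 + cos (th + 2 * x)).
    by apply: is_derive_eq; rewrite /GRing.scale /=; field.
  by rewrite derive1E; have [_ ->] := dF.
Qed.

(** * Elementary inequalities *)

Section real_inequalities.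
Context {R : realType}.

(** Multiply by 1 - x > 0: the left side is at most 1 because 1 - x <= exp(-x), and the right side
    becomes 1 + x^2 (1 - 2x) >= 1. *)
Lemma expR_le_quad (x : R) : x <= 2^-1 -> expR x <= 1 + x + 2 * x ^+ 2.
Proof.
move=> x2; have h := expR_ge1Dx (- x); have e0 := expR_gt0 x.
have E : expR x * expR (- x) = 1 by rewrite -expRD subrr expR0.
have x1 : 0 < 1 - x by lra.
rewrite -(ler_pM2r x1); apply: (@le_trans _ _ 1).
  by rewrite -[leRHS]E ler_pM2l.
have -> : (1 + x + 2 * x ^+ 2) * (1 - x) = 1 + x ^+ 2 * (1 - 2 * x) by ring.
by rewrite lerDl mulr_ge0 ?sqr_ge0//; lra.
Qed.

Lemma expRN_le_quad (x : R) : 0 <= x -> expR (- x) <= 1 - x + x ^+ 2.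
Proof.
move=> x0; have h := expR_ge1Dx x; have e0 := expR_gt0 (- x).
have E : expR (- x) * expR x = 1 by rewrite -expRD addNr expR0.
have x1 : 0 < 1 + x by lra.
rewrite -(ler_pM2r x1); apply: (@le_trans _ _ 1).
  by rewrite -[leRHS]E ler_pM2l.
have -> : (1 - x + x ^+ 2) * (1 + x) = 1 + x ^+ 3 by ring.
by rewrite lerDl exprn_ge0.
Qed.

(* theta = s / (2 (p + s)) nearly minimizes p^2 (e^theta - 1) - theta (p + s)^2. *)
Lemma upper_exponent (p s : R) : 0 <= p -> 0 < s ->
  p ^+ 2 * (expR (s / (2 * (p + s))) - 1) - s / (2 * (p + s)) * (p + s) ^+ 2
  <= - (s ^+ 2 / 4).
Proof.
move=> p0 s0; have q0 : 0 < p + s by lra.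
set x := s / (2 * (p + s)).
have xq : x * (p + s) = s / 2 by rewrite /x; field; rewrite gt_eqF.
have x0 : 0 <= x by rewrite divr_ge0; lra.
have x2 : x <= 2^-1 by rewrite -(ler_pM2r q0) xq; lra.
have e := ler_wpM2l (sqr_ge0 p) (expR_le_quad x2).
have px : x * p <= s / 2 by rewrite -xq ler_wpM2l//; lra.
have px0 : 0 <= x * p by rewrite mulr_ge0.
have -> : x * (p + s) ^+ 2 = s / 2 * (p + s) by rewrite expr2 mulrA xq.
have xs : x * p = s / 2 - x * s by rewrite -xq; ring.
have -> : p ^+ 2 * (expR x - 1) = p ^+ 2 * expR x - p ^+ 2 by ring.
have h1 : p ^+ 2 * (1 + x + 2 * x ^+ 2) = p ^+ 2 + p * (x * p) + 2 * (x * p) ^+ 2 by ring.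
rewrite h1 in e.
have h2 : p * (x * p) = p * (s / 2) - (x * p) * s by rewrite {1}xs; ring.
have h3 : 0 <= (x * p) * (s / 2 - x * p) by rewrite mulr_ge0//; lra.
have h4 : 0 < s ^+ 2 by rewrite exprn_gt0.
have h5 : 2 * (x * p) ^+ 2 <= (x * p) * s by lra.
lra.
Qed.

(* theta = - s / (2 p) nearly minimizes p^2 (e^theta - 1) - theta (p - s)^2. *)
Lemma lower_exponent (p s : R) : 0 < s -> s <= p ->
  p ^+ 2 * (expR (- (s / (2 * p))) - 1) + s / (2 * p) * (p - s) ^+ 2
  <= - (s ^+ 2 / 4).
Proof.
move=> s0 sp; have p0 : 0 < p by lra.
set x := s / (2 * p).
have xp : x * p = s / 2 by rewrite /x; field; rewrite gt_eqF.
have x0 : 0 <= x by rewrite divr_ge0; lra.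
have x2 : x <= 2^-1 by rewrite -(ler_pM2r p0) xp; lra.
have e := ler_wpM2l (sqr_ge0 p) (expRN_le_quad x0).
have -> : p ^+ 2 * (expR (- x) - 1) = p ^+ 2 * expR (- x) - p ^+ 2 by ring.
have h1 : p ^+ 2 * (1 - x + x ^+ 2) = p ^+ 2 - p * (x * p) + (x * p) ^+ 2 by ring.
rewrite h1 xp in e.
have h2 : x * (p - s) ^+ 2 = (x * p) * (p - 2 * s) + x * s ^+ 2 by ring.
rewrite h2 xp.
have h3 : x * s ^+ 2 <= 2^-1 * s ^+ 2 by rewrite ler_wpM2r ?sqr_ge0.
have h4 : (s / 2) ^+ 2 = s ^+ 2 / 4 by field.
lra.
Qed.

(** Squaring reduces the claim to Cauchy-Schwarz, which comes from expanding the sum of the squares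
    of |b| a_k - |a| b_k. A vanishing norm is treated apart, as |a| |b| is cancelled at the end. *)
Lemma l2norm_triangle (D : nat) (a b : 'I_D -> R) :
  l2norm (fun k => a k + b k) <= l2norm a + l2norm b.
Proof.
have A0 : 0 <= \sum_k a k ^+ 2 by apply: sumr_ge0 => k _; exact: sqr_ge0.
have B0 : 0 <= \sum_k b k ^+ 2 by apply: sumr_ge0 => k _; exact: sqr_ge0.
rewrite /l2norm; set A := \sum_k a k ^+ 2 in A0 *; set B := \sum_k b k ^+ 2 in B0 *.
have sA := sqr_sqrtr A0; have sB := sqr_sqrtr B0.
have qA := sqrtr_ge0 A; have qB := sqrtr_ge0 B.
set x := Num.sqrt A in sA qA *; set y := Num.sqrt B in sB qB *.
rewrite -[leRHS]ger0_norm ?addr_ge0// -sqrtr_sqr ler_wsqrtr//.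
pose C := \sum_k a k * b k.
have -> : \sum_k (a k + b k) ^+ 2 = A + B + 2 * C.
  by rewrite /A /B /C mulr_sumr -!big_split /=; apply: eq_bigr => k _; ring.
suff : C <= x * y by rewrite -sA -sB => ?; rewrite sqrrD -mulr_natl; lra.
have [x0|x0] := leP x 0.
  have A00 : A = 0 by rewrite -sA (@le_anti _ _ x 0) ?x0// expr0n.
  have a0 k : a k = 0.
    apply/eqP; rewrite -sqrf_eq0 eq_le sqr_ge0 andbT -[leRHS]A00 /A (bigD1 k)//=.
    by rewrite lerDl; apply: sumr_ge0 => i _; exact: sqr_ge0.
  by rewrite /C big1 ?mulr_ge0// => k _; rewrite a0 mul0r.
have [y0|y0] := leP y 0.
  have B00 : B = 0 by rewrite -sB (@le_anti _ _ y 0) ?y0// expr0n.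
  have b0 k : b k = 0.
    apply/eqP; rewrite -sqrf_eq0 eq_le sqr_ge0 andbT -[leRHS]B00 /B (bigD1 k)//=.
    by rewrite lerDl; apply: sumr_ge0 => i _; exact: sqr_ge0.
  by rewrite /C big1 ?mulr_ge0// => k _; rewrite b0 mulr0.
have : 0 <= \sum_k (y * a k - x * b k) ^+ 2 by apply: sumr_ge0 => k _; exact: sqr_ge0.
have -> : \sum_k (y * a k - x * b k) ^+ 2 = y ^+ 2 * A + x ^+ 2 * B - 2 * x * y * C.
  by rewrite /A /B /C !mulr_sumr -sumrN -!big_split /=; apply: eq_bigr => k _; ring.
rewrite -sA -sB => h.
have xy : 0 < x * y by rewrite mulr_gt0.
by rewrite -(ler_pM2l xy); lra.
Qed.

(* The first bound is concavity of the square root at q^2, the second is AM-GM. *)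
Lemma sqrt_step (D : nat) (alpha : R) (v e : 'I_D -> R) : 0 < alpha ->
  \sum_k e k ^+ 2 <= 8 ->
  let q := Num.sqrt (alpha ^+ 2 + \sum_k v k ^+ 2) in
  Num.sqrt (alpha ^+ 2 + \sum_k (v k + e k) ^+ 2) <=
    q + \sum_k v k / q * e k + 4 / alpha /\
  `|\sum_k v k / q * e k| <= 3.
Proof.
move=> a0 e8 q.
have V0 : 0 <= \sum_k v k ^+ 2 by apply: sumr_ge0 => k _; exact: sqr_ge0.
have a20 : 0 < alpha ^+ 2 by rewrite exprn_gt0.
have q2 : q ^+ 2 = alpha ^+ 2 + \sum_k v k ^+ 2 by rewrite sqr_sqrtr//; lra.
have qa : alpha <= q.
  by rewrite -[alpha]gtr0_norm// -sqrtr_sqr ler_wsqrtr// lerDl.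
have q0 : 0 < q by exact: lt_le_trans qa.
set z := \sum_k v k / q * e k; set S := \sum_k e k ^+ 2 in e8.
have S0 : 0 <= S by apply: sumr_ge0 => k _; exact: sqr_ge0.
have E : \sum_k (v k + e k) ^+ 2 = \sum_k v k ^+ 2 + 2 * q * z + S.
  rewrite /S /z mulr_sumr -!big_split /=; apply: eq_bigr => k _.
  by field; rewrite gt_eqF.
have N0 : 0 <= \sum_k (v k + e k) ^+ 2 by apply: sumr_ge0 => k _; exact: sqr_ge0.
split.
  apply: (@le_trans _ _ (q + z + S / (2 * q))).
    (* Nonnegativity allows the comparison of squares: 2q times this quantity is q^2 + alpha^2 + |v
       + e|^2. *)
    have r0 : 0 <= q + z + S / (2 * q).
      rewrite -(pmulr_rge0 _ (mulr_gt0 (ltr0Sn R 1) q0)).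
      have -> : 2 * q * (q + z + S / (2 * q)) = q ^+ 2 + (q ^+ 2 + 2 * q * z + S).
        by field; rewrite gt_eqF.
      rewrite q2; lra.
    rewrite -[leRHS]ger0_norm// -sqrtr_sqr ler_wsqrtr//.
    rewrite E addrA addrA -q2 -subr_ge0.
    have -> : (q + z + S / (2 * q)) ^+ 2 - (q ^+ 2 + 2 * q * z + S) = (z + S / (2 * q)) ^+ 2.
      by field; rewrite gt_eqF.
    exact: sqr_ge0.
  rewrite lerD2l ler_pdivrMr ?mulr_gt0// mulrCA mulrAC.
  have : 1 <= q / alpha by rewrite ler_pdivlMr// mul1r.
  lra.
(* The weights come from (3a - b)^2 >= 0. With |v / q| <= 1 and |e|^2 <= 8 they give 3/2 + 8/6 =
   17/6 <= 3. *)
apply: (@le_trans _ _ (\sum_k (3 / 2 * (v k ^+ 2 / q ^+ 2) + 6^-1 * e k ^+ 2))).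
  apply: (le_trans (ler_norm_sum _ _ _)); apply: ler_sum => k _.
  have -> : v k ^+ 2 / q ^+ 2 = `|v k / q| ^+ 2 by rewrite real_normK ?num_real// expr_div_n.
  rewrite -[e k ^+ 2]real_normK ?num_real// normrM.
  have := sqr_ge0 (3 * `|v k / q| - `|e k|); lra.
rewrite big_split /= -!mulr_sumr -mulr_suml -/S.
have : (\sum_k v k ^+ 2) / q ^+ 2 <= 1 by rewrite q2 ler_pdivrMr ?mul1r; lra.
lra.
Qed.

End real_inequalities.

Lemma measurable_sum_in {R : realType} {d} {T : measurableType d} (I : eqType)
    (s : seq I) (f : I -> T -> R) :
  (forall i, i \in s -> measurable_fun setT (f i)) ->
  measurable_fun setT (fun t => \sum_(i <- s) f i t).
Proof.
elim: s => [|i s IH] mf.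
  by under eq_fun do rewrite big_nil; exact: measurable_cst.
under eq_fun do rewrite big_cons.
apply: measurable_funD; first by apply: mf; rewrite mem_head.
by apply: IH => j js; apply: mf; rewrite in_cons js orbT.
Qed.

(** * Random Fourier features *)

Section rff_integrals.
Context {R : realType} {d : nat}.

Lemma measurable_dotv {dS} {S : measurableType dS} (V V' : S -> d.-tuple R) :
  measurable_fun setT V -> measurable_fun setT V' ->
  measurable_fun setT (fun t => dotv (V t) (V' t)).
Proof.
move=> mV mV'; apply: measurable_sum => j; apply: measurable_funM.
  exact: (measurableT_comp (measurable_tnth j) mV).
exact: (measurableT_comp (measurable_tnth j) mV').
Qed.

Definition mean_cos (rho : probability (d.-tuple R) R) (w : d.-tuple R) (b : R) : R :=
  \int[rho]_x cos (dotv w x + b).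

Lemma bmf_cos_dotv {dS} {S : measurableType dS} (V V' : S -> d.-tuple R) (b : S -> R) :
  measurable_fun setT V -> measurable_fun setT V' -> measurable_fun setT b ->
  bmf (fun t => cos (dotv (V t) (V' t) + b t)).
Proof.
by move=> mV mV' mb; apply: bmf_cos; apply: measurable_funD => //; exact: measurable_dotv.
Qed.

Lemma bmf_cos_dotv_prod {dS} {S : measurableType dS} (V : S -> d.-tuple R) (b : S -> R) :
  measurable_fun setT V -> measurable_fun setT b ->
  bmf (fun z : S * d.-tuple R => cos (dotv (V z.1) z.2 + b z.1)).
Proof.
move=> mV mb; apply: bmf_cos_dotv => //; first exact: (measurableT_comp mV).
exact: (measurableT_comp mb).
Qed.

Lemma bmf_mean_cos {dS} {S : measurableType dS} rho (V : S -> d.-tuple R) (b : S -> R) :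
  measurable_fun setT V -> measurable_fun setT b ->
  bmf (fun t => mean_cos rho (V t) (b t)).
Proof. by move=> mV mb; have := bmf_fubini rho (bmf_cos_dotv_prod mV mb). Qed.

Lemma mean_cos_le1 rho w b : `|mean_cos rho w b| <= 1.
Proof.
apply: expect_norm_le => [|x]; last exact: cos_max.
by apply: bmf_cos_dotv => //; exact: measurable_cst.
Qed.

Lemma bmf_gauss_kernel sigma :
  bmf (fun z : d.-tuple R * d.-tuple R => gauss_kernel sigma z.1 z.2).
Proof.
have mk : measurable_fun setT
    (fun z : d.-tuple R * d.-tuple R => gauss_kernel sigma z.1 z.2).
  apply: (measurableT_comp (@measurable_expR R)).
  apply: measurable_funM => //; apply: (measurableT_comp (@oppr_measurable R _)).
  apply: measurable_sum => j; apply: measurable_funX.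
  apply: measurable_funB.
    exact: (measurableT_comp (measurable_tnth j)).
  exact: (measurableT_comp (measurable_tnth j)).
split=> //; exists 1 => z; rewrite ger0_norm ?expR_ge0//.
rewrite -expR0 ler_expR mulNr oppr_le0 divr_ge0 ?[0 <= 2 * _]mulr_ge0 ?exprn_even_ge0//.
by apply: sumr_ge0 => j _; exact: sqr_ge0.
Qed.

Definition kernel_meanR sigma (mu nu : probability (d.-tuple R) R) : R :=
  \int[mu]_x \int[nu]_y gauss_kernel sigma x y.

Lemma kernel_meanE sigma (mu nu : probability (d.-tuple R) R) :
  kernel_mean sigma mu nu = (kernel_meanR sigma mu nu)%:E.
Proof.
have bk := bmf_gauss_kernel sigma.
rewrite /kernel_meanR (EFin_expect mu (bmf_fubini nu bk)); apply: eq_integral => x _.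
by rewrite (EFin_expect nu (bmf_section1 bk x)).
Qed.

Lemma MMD2E sigma (mu nu : probability (d.-tuple R) R) :
  MMD2 sigma mu nu = kernel_meanR sigma mu mu + kernel_meanR sigma nu nu
    - 2 * kernel_meanR sigma mu nu.
Proof. by rewrite /MMD2 !kernel_meanE. Qed.

End rff_integrals.

(** * The experiment and its independent variables *)

Section experiment.
Context {R : realType} {d : nat} {sigma : R}.
Hypothesis sigma_gt0 : 0 < sigma.
Context {dT : measure_display} {T : measurableType dT}.
Variables (P : probability T R) (rho1 rho2 : probability (d.-tuple R) R) (D n : nat).
Variables (W : 'I_D -> 'I_d -> T -> R) (B : 'I_D -> T -> R).
Variables (X Y : 'I_n -> T -> d.-tuple R).
Hypothesis lawW : forall k j, has_law P (W k j) (normal_prob 0 sigma^-1).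
Hypothesis lawB : forall k, has_law P (B k) unif_0_2pi.
Hypothesis lawX : forall i, has_law P (X i) rho1.
Hypothesis lawY : forall i, has_law P (Y i) rho2.
Hypothesis indE : mutually_independent P (rff_events W B X Y).

Local Notation E := (rff_events W B X Y).
(** The sample space with the sigma-algebra of all variables but the i-th: measurability over it
    expresses that a function does not involve that variable. *)
Local Notation "''T_' i" := (g_sigma_algebraType (others E i)) (at level 8, i at level 2).

Lemma preimg_setsT {d'} {T' : measurableType d'} (V : T -> T') : preimg_sets V setT.
Proof. by exists setT; [exact: measurableT|exact: preimage_setT]. Qed.

Lemma preimg_sets_setI {d'} {T' : measurableType d'} (V : T -> T') :
  setI_closed (preimg_sets V).
Proof.
by move=> _ _ [A mA <-] [C mC <-]; exists (A `&` C) => //; exact: measurableI.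
Qed.

Lemma preimg_sets_measurable {d'} {T' : measurableType d'} (V : T -> T') :
  measurable_fun setT V -> preimg_sets V `<=` measurable.
Proof.
by move=> mV _ [A mA <-]; rewrite -[X in measurable X]setTI; exact: mV.
Qed.

Lemma rff_events_setT i : E i setT.
Proof. by case: i => [[k j]|[k|[k|k]]]; exact: preimg_setsT. Qed.

Lemma rff_events_setI i : setI_closed (E i).
Proof. by case: i => [[k j]|[k|[k|k]]]; exact: preimg_sets_setI. Qed.

Lemma rff_events_measurable i : E i `<=` measurable.
Proof.
case: i => [[k j]|[k|[k|k]]]; apply: preimg_sets_measurable.
- exact: (lawW k j).1.
- exact: (lawB k).1.
- exact: (lawX k).1.
- exact: (lawY k).1.
Qed.

Let ET := rff_events_setT.
Let EI := rff_events_setI.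
Let Em := rff_events_measurable.

Lemma measurable_off i j d' (T' : measurableType d') (V : T -> T') :
  j != i -> E j = preimg_sets V -> measurable_fun (setT : set 'T_i) V.
Proof.
move=> ji EV _ A mA; rewrite setTI; apply: sub_sigma_algebra.
by apply: (sub_others ET ji); rewrite EV; exists A.
Qed.

Lemma bmf_off i (f : 'T_i -> R) : bmf f -> bmf (f : T -> R).
Proof. exact: (bmf_others Em). Qed.

(** * Moments of the cosine features *)

Definition freq (k : 'I_D) (t : T) : d.-tuple R := [tuple W k j t | j < d].

Lemma measurable_freq_off i k : (forall j, inl (k, j) != i) ->
  measurable_fun (setT : set 'T_i) (freq k).
Proof.
move=> ki; apply/measurable_fun_tnthP => j.
rewrite (_ : _ \o _ = W k j); last by apply/funext => t /=; rewrite tnth_mktuple.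
exact: (measurable_off (ki j)).
Qed.

Lemma measurable_phase_off i k : inr (inl k) != i ->
  measurable_fun (setT : set 'T_i) (B k).
Proof. by move=> ki; exact: (measurable_off ki). Qed.

(** Induction on the coordinates: each one is integrated out with everything else absorbed in the
    phase, and [expect_normal_cos] returns the cosine of that phase times one Gaussian factor. *)
Lemma expect_cos_gauss k (u : 'I_d -> R) (s : seq 'I_d) (H a : T -> R) :
  uniq s ->
  (forall j, @bmf R _ 'T_(inl (k, j)) H) ->
  (forall j, measurable_fun (setT : set 'T_(inl (k, j))) a) ->
  \int[P]_t (H t * cos (a t + \sum_(j <- s) u j * W k j t)) =
  (\int[P]_t (H t * cos (a t))) * \prod_(j <- s) expR (- (u j ^+ 2 / (2 * sigma ^+ 2))).
Proof.
move=> + bH ma; elim: s => [|j s IH] /=.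
  move=> _; rewrite big_nil mulr1; apply: eq_Rintegral => t _.
  by rewrite big_nil addr0.
move=> /andP[js us]; rewrite big_cons mulrCA mulrC -IH//.
have uk j' : j' != j -> inl (k, j') != inl (k, j) :> rff_index d D n.
  by apply: contra => /eqP[->].
have mA : measurable_fun (setT : set 'T_(inl (k, j)))
    (fun t => a t + \sum_(j <- s) u j * W k j t).
  apply: measurable_funD; first exact: ma.
  apply: measurable_sum_in => j' j's; apply: measurable_funM => //.
  by apply: (@measurable_off _ (inl (k, j'))) => //; apply: uk; apply: contraNneq js => <-.
have bf : bmf (fun z : 'T_(inl (k, j)) * R =>
    H z.1 * cos (a z.1 + \sum_(j <- s) u j * W k j z.1 + u j * z.2)).
  apply: bmfM; first exact: (bmf_comp measurable_fst (bH j)).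
  apply: bmf_cos; apply: measurable_funD; first exact: (measurableT_comp mA measurable_fst).
  by apply: measurable_funM => //; exact: measurable_snd.
pose N : probability (measurableTypeR R) R := normal_prob 0 sigma^-1.
have := expect_indep ET EI Em indE (rho := N) (lawW k j) (erefl : E (inl (k, j)) = preimg_sets (W k j)) bf.
move=> /= eq1; transitivity (\int[P]_t (H t * cos (a t + \sum_(j <- s) u j * W k j t + u j * W k j t))).
  by apply: eq_Rintegral => t _; rewrite big_cons [u j * _ + _]addrC addrA.
rewrite eq1 -expectZr; last first.
  by apply: bmf_off; apply: bmfM; [exact: bH|exact: bmf_cos].
apply: eq_Rintegral => t _.
rewrite expectZl; last by apply: bmf_cos; apply: measurable_funD => //; exact: measurable_funM.
rewrite expect_normal_cos ?invr_gt0// mulrA; congr (_ * expR (- _)).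
by field; rewrite gt_eqF.
Qed.

Lemma expect_cos_phase k (H a : 'T_(inr (inl k)) -> R) :
  bmf H -> measurable_fun setT a ->
  \int[P]_t (H t * cos (a t + 2 * B k t)) = 0.
Proof.
move=> bH ma.
have bf : bmf (fun z : 'T_(inr (inl k)) * R => H z.1 * cos (a z.1 + 2 * z.2)).
  apply: bmfM; first exact: (bmf_comp measurable_fst bH).
  apply: bmf_cos; apply: measurable_funD; first exact: (measurableT_comp ma measurable_fst).
  by apply: measurable_funM => //; exact: measurable_snd.
pose U : probability (measurableTypeR R) R := unif_0_2pi.
have := expect_indep ET EI Em indE (rho := U) (lawB k) (erefl : E (inr (inl k)) = preimg_sets (B k)) bf.
move=> /= ->; rewrite -[RHS](expect_cst P); apply: eq_Rintegral => t _.
rewrite expectZl; last by apply: bmf_cos; apply: measurable_funD => //; exact: measurable_funM.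
by rewrite expect_uniform_cos mulr0.
Qed.

(* f depends only on variables other than the frequency and the phase of feature k. *)
Definition bmf_off_feature k (f : T -> R) :=
  (forall j, @bmf R _ 'T_(inl (k, j)) f) /\ @bmf R _ 'T_(inr (inl k)) f.

Lemma measurable_freq k : measurable_fun setT (freq k).
Proof.
apply/measurable_fun_tnthP => j.
rewrite (_ : _ \o _ = W k j); last by apply/funext => t /=; rewrite tnth_mktuple.
exact: (lawW k j).1.
Qed.

Lemma measurable_phase k : measurable_fun setT (B k).
Proof. exact: (lawB k).1. Qed.

(** By the product formula, cos p cos q is half of cos(p - q) + cos(p + q). The difference is free
    of the random phase and yields the kernel; the sum contains 2 b_k and averages to zero. The
    weight [H] stands for the contribution of the other features. *)
Lemma expect_cos_cos k (x y : d.-tuple R) (H : T -> R) : bmf_off_feature k H ->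
  \int[P]_t (H t * (cos (dotv (freq k t) x + B k t) * cos (dotv (freq k t) y + B k t)))
  = (\int[P]_t H t) * (gauss_kernel sigma x y / 2).
Proof.
move=> [bHW bHB]; have bH := bmf_off bHB.
pose u j := tnth x j - tnth y j.
pose A t := dotv (freq k t) x + dotv (freq k t) y.
have mA : measurable_fun (setT : set 'T_(inr (inl k))) A.
  by apply: measurable_funD; apply: measurable_dotv => //; exact: measurable_freq_off.
have bA : bmf (fun t => H t * cos (A t + 2 * B k t)).
  apply: bmfM => //; apply: bmf_cos; apply: measurable_funD.
    by apply: measurable_funD; apply: measurable_dotv => //; exact: measurable_freq.
  by apply: measurable_funM => //; exact: measurable_phase.
have bu : bmf (fun t => H t * cos (0 + \sum_(j <- index_enum 'I_d) u j * W k j t)).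
  apply: bmfM => //; apply: bmf_cos; apply: measurable_funD => //.
  by apply: measurable_sum => j; apply: measurable_funM => //; exact: (lawW k j).1.
transitivity (\int[P]_t (2^-1 * (H t * cos (0 + \sum_(j <- index_enum 'I_d) u j * W k j t)
    + H t * cos (A t + 2 * B k t)))).
  apply: eq_Rintegral => t _.
  have -> : 0 + \sum_(j <- index_enum 'I_d) u j * W k j t =
      (dotv (freq k t) x + B k t) - (dotv (freq k t) y + B k t).
    rewrite add0r opprD addrACA subrr addr0 /dotv -sumrB; apply: eq_bigr => j _.
    by rewrite tnth_mktuple -mulrBr mulrC.
  have -> : A t + 2 * B k t = (dotv (freq k t) x + B k t) + (dotv (freq k t) y + B k t).
    by rewrite /A; ring.
  move: (dotv _ x + _) (dotv _ y + _) => p q.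
  by rewrite cosB cosD; field.
rewrite expectZl; last exact: bmfD.
rewrite expectD// expect_cos_phase// addr0.
rewrite (@expect_cos_gauss k u _ H (fun=> 0))//; last exact: index_enum_uniq.
rewrite mulrC -mulrA; congr (_ * _).
  by apply: eq_Rintegral => t _; rewrite cos0 mulr1.
rewrite /gauss_kernel /sqdist; congr (_ / _).
by rewrite mulNr mulr_suml -sumrN expR_sum.
Qed.

Definition feature_mean (mu : probability (d.-tuple R) R) k t :=
  mean_cos mu (freq k t) (B k t).

Lemma bmf_feature_mean mu k : bmf (feature_mean mu k).
Proof. by apply: bmf_mean_cos; [exact: measurable_freq|exact: measurable_phase]. Qed.

(** Fubini moves the averages over the two points outside, where [expect_cos_cos] applies for fixed
    x and y. *)
Lemma expect_feature_mean k (mu nu : probability (d.-tuple R) R) (H : T -> R) :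
  bmf_off_feature k H ->
  \int[P]_t (H t * (feature_mean mu k t * feature_mean nu k t)) =
  (\int[P]_t H t) * (kernel_meanR sigma mu nu / 2).
Proof.
move=> offH; have bH := bmf_off offH.2.
have mw := measurable_freq k; have mb := measurable_phase k.
pose c z : R := cos (dotv (freq k z.1) z.2 + B k z.1).
have bc : bmf (c : T * d.-tuple R -> R) := bmf_cos_dotv_prod mw mb.
have bHc : bmf (fun z : T * d.-tuple R => H z.1 * (c z * feature_mean nu k z.1)).
  apply: bmfM; first exact: (bmf_comp measurable_fst bH).
  by apply: bmfM => //; exact: (bmf_comp measurable_fst (bmf_feature_mean nu k)).
transitivity (\int[P]_t \int[mu]_x (H t * (c (t, x) * feature_mean nu k t))).
  apply: eq_Rintegral => t _; rewrite expectZl.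
    by rewrite expectZr//; exact: (bmf_section1 bc t).
  apply: bmfM; [exact: (bmf_section1 bc t)|exact: bmf_cst].
rewrite (expect_fubini P mu bHc).
have bk := bmf_gauss_kernel sigma (d := d).
rewrite /kernel_meanR -[X in _ = _ * X]expectZr; last exact: (bmf_fubini nu bk).
rewrite -expectZl; last by apply: bmfM; [exact: (bmf_fubini nu bk)|exact: bmf_cst].
apply: eq_Rintegral => x _.
have bHcc : bmf (fun z : T * d.-tuple R => H z.1 * (c (z.1, x) * c z)).
  apply: bmfM; first exact: (bmf_comp measurable_fst bH).
  by apply: bmfM => //; exact: (bmf_comp measurable_fst (bmf_section2 bc x)).
transitivity (\int[P]_t \int[nu]_y (H t * (c (t, x) * c (t, y)))).
  apply: eq_Rintegral => t _ /=.
  have bct := bmf_section1 bc t.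
  rewrite expectZl; last by apply: bmfM => //; exact: bmf_cst.
  by rewrite expectZl.
rewrite (expect_fubini P nu bHcc) -[X in _ = _ * X]expectZr; last exact: (bmf_section1 bk x).
rewrite -expectZl; last by apply: bmfM; [exact: (bmf_section1 bk x)|exact: bmf_cst].
by apply: eq_Rintegral => y _; exact: expect_cos_cos.
Qed.

Definition feature_gap2 k t :=
  2 * (feature_mean rho1 k t - feature_mean rho2 k t) ^+ 2.

Lemma bmf_feature_gap2 k : bmf (feature_gap2 k).
Proof. by apply/bmfZ/bmfX/bmfB; exact: bmf_feature_mean. Qed.

Lemma feature_gap2_bounds k t : 0 <= feature_gap2 k t <= 8.
Proof.
rewrite mulr_ge0 ?sqr_ge0//=.
have := mean_cos_le1 rho1 (freq k t) (B k t); have := mean_cos_le1 rho2 (freq k t) (B k t).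
rewrite /feature_gap2 /feature_mean !ler_norml => /andP[? ?] /andP[? ?]; nra.
Qed.

(** Expanding the square gives three kernel means. With a weight [H] off feature k, the identity
    says that the mean given the other features is still MMD^2. *)
Lemma expect_feature_gap2 k (H : T -> R) : bmf_off_feature k H ->
  \int[P]_t (H t * feature_gap2 k t) = (\int[P]_t H t) * MMD2 sigma rho1 rho2.
Proof.
move=> offH; have bH := bmf_off offH.2.
have bHc mu nu : bmf (fun t => H t * (feature_mean mu k t * feature_mean nu k t)).
  by apply: bmfM => //; apply: bmfM; exact: bmf_feature_mean.
transitivity (\int[P]_t (2 * (H t * (feature_mean rho1 k t * feature_mean rho1 k t))
   + 2 * (H t * (feature_mean rho2 k t * feature_mean rho2 k t))
   - 4 * (H t * (feature_mean rho1 k t * feature_mean rho2 k t)))).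
  by apply: eq_Rintegral => t _; rewrite /feature_gap2; ring.
rewrite expectB; [|by apply: bmfD; exact: bmfZ|exact: bmfZ].
rewrite expectD; [|exact: bmfZ|exact: bmfZ].
by rewrite !expectZl// !expect_feature_mean// MMD2E; field.
Qed.

(** MMD^2 is the expectation of a variable with values in [0, 8]. The argument k provides a feature
    from which to read it off. *)
Lemma MMD2_bounds (k : 'I_D) : 0 <= MMD2 sigma rho1 rho2 <= 8.
Proof.
have off1 : bmf_off_feature k (fun=> 1) by split=> *; exact: bmf_cst.
have := expect_feature_gap2 off1; rewrite expect_cst mul1r => <-.
under eq_Rintegral do rewrite mul1r.
rewrite expect_ge0/=; last by move=> t; have /andP[] := feature_gap2_bounds k t.
rewrite -[leRHS](expect_cst P); apply: expect_le; [exact: bmf_feature_gap2|exact: bmf_cst|].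
by move=> t; have /andP[] := feature_gap2_bounds k t.
Qed.

(** Convexity from the tangent at theta q: its values at 0 and theta lie below exp, and they are
    averaged with weights 1 - q and q. *)
Lemma expR_chord (theta q : R) : 0 <= q <= 1 ->
  expR (theta * q) <= 1 + (expR theta - 1) * q.
Proof.
move=> /andP[q0 q1]; set y := theta * q.
have e1 := expR_ge1Dx (- y); have e2 := expR_ge1Dx (theta - y).
have y0 := expR_gt0 y.
have E1 : expR y * expR (- y) = 1 by rewrite -expRD subrr expR0.
have E2 : expR y * expR (theta - y) = expR theta by rewrite -expRD addrC subrK.
have h1 : expR y * (1 - y) <= 1 by rewrite -[leRHS]E1 ler_pM2l.
have h2 : expR y * (1 + (theta - y)) <= expR theta by rewrite -E2 ler_pM2l.
have h3 : (1 - q) * (expR y * (1 - y)) <= 1 - q by rewrite ler_piMr ?subr_ge0.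
have h4 : q * (expR y * (1 + (theta - y))) <= q * expR theta by rewrite ler_wpM2l.
have -> : expR y = (1 - q) * (expR y * (1 - y)) + q * (expR y * (1 + (theta - y))).
  by rewrite /y; ring.
lra.
Qed.

(** * Exponential moments and tails of the feature distance *)

Lemma bmf_off_feature_gap2 k k' : k' != k -> bmf_off_feature k (feature_gap2 k').
Proof.
move=> kk; split=> [j|]; apply/bmfZ/bmfX/bmfB; apply: bmf_mean_cos.
- by apply: measurable_freq_off => j'; apply: contra kk => /eqP[->].
- exact: measurable_phase_off.
- by apply: measurable_freq_off => j'; apply: contra kk => /eqP[->].
- exact: measurable_phase_off.
- exact: measurable_freq_off.
- by apply: measurable_phase_off; apply: contra kk => /eqP[->].
- exact: measurable_freq_off.
- by apply: measurable_phase_off; apply: contra kk => /eqP[->].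
Qed.

(** Features are removed one at a time: the chord bound is linear in the new gap, whose mean given
    the others is MMD^2, and 1 + x <= exp x restores an exponential. *)
Lemma feature_mgf (theta : R) (s : seq 'I_D) : uniq s ->
  \int[P]_t expR (theta * ((\sum_(k <- s) feature_gap2 k t) / 8)) <=
  expR ((size s)%:R * (MMD2 sigma rho1 rho2 / 8 * (expR theta - 1))).
Proof.
elim: s => [|k s IH] /=.
  move=> _; under eq_Rintegral do rewrite big_nil mul0r mulr0 expR0.
  by rewrite expect_cst mul0r expR0.
move=> /andP[ks us].
pose H t := expR (theta * ((\sum_(k <- s) feature_gap2 k t) / 8)).
have offH : bmf_off_feature k H.
  split=> [j|]; apply/bmf_expR/bmfZ/bmfM; try exact: bmf_cst; apply: bmf_sum_in => k' k's.
    by apply: (bmf_off_feature_gap2 _).1; apply: contraNneq ks => <-.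
  by apply: (bmf_off_feature_gap2 _).2; apply: contraNneq ks => <-.
have bH := bmf_off offH.2.
have bg := bmf_feature_gap2 k.
have b1 : bmf (fun t => H t * expR (theta * (feature_gap2 k t / 8))).
  by apply: bmfM => //; apply/bmf_expR/bmfZ/bmfM => //; exact: bmf_cst.
have b2 : bmf (fun t => (expR theta - 1) / 8 * (H t * feature_gap2 k t)).
  by apply/bmfZ/bmfM.
have -> : \int[P]_t expR (theta * ((\sum_(k <- k :: s) feature_gap2 k t) / 8)) =
    \int[P]_t (H t * expR (theta * (feature_gap2 k t / 8))).
  by apply: eq_Rintegral => t _; rewrite /H big_cons -expRD; congr expR; ring.
apply: (@le_trans _ _ (\int[P]_t (H t + (expR theta - 1) / 8 * (H t * feature_gap2 k t)))).
  apply: expect_le => // [|t]; first exact: bmfD.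
  have /andP[g0 g8] := feature_gap2_bounds k t.
  have : expR (theta * (feature_gap2 k t / 8)) <= 1 + (expR theta - 1) * (feature_gap2 k t / 8).
    by apply: expR_chord; rewrite divr_ge0//= ler_pdivrMr// mul1r.
  move=> /(ler_wpM2l (expR_ge0 (theta * ((\sum_(k <- s) feature_gap2 k t) / 8)))) /le_trans; apply.
  by rewrite le_eqVlt; apply/orP; left; apply/eqP; rewrite /H; ring.
rewrite expectD// expectZl ?expect_feature_gap2//; last exact: bmfM.
set m := MMD2 sigma rho1 rho2.
have -> : \int[P]_t H t + (expR theta - 1) / 8 * ((\int[P]_t H t) * m) =
  (1 + m / 8 * (expR theta - 1)) * \int[P]_t H t by ring.
rewrite -[(size s).+1%:R]natr1 [X in _ <= expR X]mulrDl mul1r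
  [X in _ <= expR X]addrC expRD.
apply: (@le_trans _ _ (expR (m / 8 * (expR theta - 1)) * \int[P]_t H t)).
  by rewrite ler_wpM2r ?expR_ge1Dx// expect_ge0// => t; exact: expR_ge0.
by rewrite ler_wpM2l ?expR_ge0//; exact: IH.
Qed.


(* |m|^2 in the notation of the header. *)
Definition feature_dist2 t := D%:R^-1 * \sum_(k < D) feature_gap2 k t.

Hypothesis D_gt0 : (0 < D)%N.

Let mmd := MMD sigma rho1 rho2.

Let mmd2 : mmd ^+ 2 = MMD2 sigma rho1 rho2.
Proof. by rewrite sqr_sqrtr//; have /andP[] := MMD2_bounds (Ordinal D_gt0). Qed.

Lemma feature_dist2_bounds t : 0 <= feature_dist2 t <= 8.
Proof.
have D0 : 0 < D%:R :> R by rewrite ltr0n.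
rewrite mulr_ge0 ?invr_ge0 ?(ltW D0)//=; last first.
  by apply: sumr_ge0 => k _; have /andP[] := feature_gap2_bounds k t.
rewrite /feature_dist2 mulrC ler_pdivrMr//; apply: (@le_trans _ _ (\sum_(k < D) 8)).
  by apply: ler_sum => k _; have /andP[] := feature_gap2_bounds k t.
by rewrite sumr_const card_ord mulr_natr.
Qed.

Let sum_gap2E t : \sum_(k < D) feature_gap2 k t = D%:R * feature_dist2 t.
Proof. by rewrite mulVKf// pnatr_eq0 -lt0n. Qed.

(** The constant [c] carries the threshold term, so that the exponent becomes D/8 times the
    expression bounded in [upper_exponent] and [lower_exponent]. *)
Lemma feature_mgfD (theta c : R) :
  \int[P]_t expR (D%:R / 8 * (theta * feature_dist2 t + c)) <=
  expR (D%:R / 8 * (mmd ^+ 2 * (expR theta - 1) + c)).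
Proof.
have := feature_mgf theta (index_enum_uniq 'I_D).
rewrite -sum1_size sum_nat_const card_ord muln1 -mmd2 => h.
have := ler_wpM2r (expR_ge0 (D%:R / 8 * c)) h; rewrite -expRD.
rewrite -expectZr; last first.
  apply: bmf_expR; apply/bmfZ/bmfM; last exact: bmf_cst.
  by apply: bmf_sum => k; exact: bmf_feature_gap2.
have <- : D%:R * (mmd ^+ 2 / 8 * (expR theta - 1)) + D%:R / 8 * c =
  D%:R / 8 * (mmd ^+ 2 * (expR theta - 1) + c) by ring.
apply: le_trans; rewrite le_eqVlt; apply/orP; left; apply/eqP.
apply: eq_Rintegral => t _; rewrite -expRD; congr expR.
by rewrite sum_gap2E; ring.
Qed.

Lemma bmf_feature_exp theta c :
  bmf (fun t => expR (D%:R / 8 * (theta * feature_dist2 t + c))).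
Proof.
apply/bmf_expR/bmfZ/bmfD; last exact: bmf_cst.
by apply/bmfZ/bmfZ/bmf_sum => k; exact: bmf_feature_gap2.
Qed.

(** Chernoff's bound with the parameter of [upper_exponent]; the rate is D/8 times s^2 / 4. *)
Lemma feature_upper_tail (s : R) : 0 < s ->
  exists f : T -> R, [/\ bmf f, forall t, 0 <= f t,
    forall t, mmd + s <= Num.sqrt (feature_dist2 t) -> 1 <= f t &
    \int[P]_t f t <= expR (- (D%:R * s ^+ 2 / 32))].
Proof.
move=> s0; have m0 : 0 <= mmd by exact: sqrtr_ge0.
pose th := s / (2 * (mmd + s)).
have th0 : 0 <= th by rewrite divr_ge0; lra.
exists (fun t => expR (D%:R / 8 * (th * feature_dist2 t - th * (mmd + s) ^+ 2))); split.
- exact: bmf_feature_exp.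
- by move=> t; exact: expR_ge0.
- move=> t h; rewrite -[leLHS]expR0 ler_expR mulr_ge0 ?divr_ge0// subr_ge0.
  have /andP[z0 _] := feature_dist2_bounds t.
  rewrite ler_wpM2l// -(sqr_sqrtr z0) ler_pXn2r ?nnegrE ?sqrtr_ge0//; lra.
- apply: le_trans (feature_mgfD _ _) _; rewrite ler_expR.
  have := ler_wpM2l (divr_ge0 (ler0n R D) (ler0n R 8)) (upper_exponent m0 s0).
  rewrite -/th; lra.
Qed.

Lemma feature_lower_tail (s : R) : 0 < s ->
  exists f : T -> R, [/\ bmf f, forall t, 0 <= f t,
    forall t, Num.sqrt (feature_dist2 t) <= mmd - s -> 1 <= f t &
    \int[P]_t f t <= expR (- (D%:R * s ^+ 2 / 32))].
Proof.
(* If MMD < s, the square root would have to be negative: the event is empty and f = 0 dominates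
   it. *)
move=> s0; have [ms|sm] := ltP mmd s.
  exists (fun=> 0); split => //; first exact: bmf_cst.
    by move=> t h; have := sqrtr_ge0 (feature_dist2 t); lra.
  by rewrite expect_cst expR_ge0.
pose th := s / (2 * mmd).
have th0 : 0 <= th by rewrite divr_ge0; lra.
exists (fun t => expR (D%:R / 8 * (- th * feature_dist2 t + th * (mmd - s) ^+ 2))); split.
- exact: bmf_feature_exp.
- by move=> t; exact: expR_ge0.
- move=> t h; rewrite -[leLHS]expR0 ler_expR mulr_ge0 ?divr_ge0// mulNr addrC subr_ge0.
  have /andP[z0 _] := feature_dist2_bounds t.
  by rewrite ler_wpM2l// -(sqr_sqrtr z0) ler_pXn2r ?nnegrE ?sqrtr_ge0//; lra.
- apply: le_trans (feature_mgfD _ _) _; rewrite ler_expR.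
  have := ler_wpM2l (divr_ge0 (ler0n R D) (ler0n R 8)) (lower_exponent s0 sm).
  rewrite -/th; lra.
Qed.

(** * Centered noise of the samples *)

Let V (s : 'I_n + 'I_n) : T -> d.-tuple R := match s with inl i => X i | inr i => Y i end.
Let rho (s : 'I_n + 'I_n) : probability (d.-tuple R) R :=
  match s with inl _ => rho1 | inr _ => rho2 end.
(** Both samples form one family of 2n variables; the sign reflects that the second mean feature is
    subtracted. *)
Let sgnV (s : 'I_n + 'I_n) : R := match s with inl _ => 1 | inr _ => -1 end.

Let lawV s : has_law P (V s) (rho s).
Proof. by case: s => i; [exact: lawX|exact: lawY]. Qed.

Let EV s : E (inr (inr s)) = preimg_sets (V s).
Proof. by case: s. Qed.

(* The noise terms add up to n (phi_1 - phi_2 - m); see mean_feature_diff. *)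
Definition noise s k t :=
  sgnV s * Num.sqrt (2 / D%:R) *
  (cos (dotv (freq k t) (V s t) + B k t) - feature_mean (rho s) k t).

Lemma bmf_noise s k : bmf (noise s k).
Proof.
apply/bmfZ/bmfB; last exact: bmf_feature_mean.
by apply: bmf_cos_dotv; [exact: measurable_freq|exact: (lawV s).1|exact: measurable_phase].
Qed.

Lemma bmf_noise_off s s' k : s' != s -> @bmf R _ 'T_(inr (inr s)) (noise s' k).
Proof.
move=> ss; apply/bmfZ/bmfB.
  apply: bmf_cos_dotv; [exact: measurable_freq_off| |exact: measurable_phase_off].
  by apply: (@measurable_off _ (inr (inr s'))); [|exact: EV].
by apply: bmf_mean_cos; [exact: measurable_freq_off|exact: measurable_phase_off].
Qed.

(** With all variables but sample s frozen, the mean of the cosine is exactly the feature mean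
    subtracted in [noise]. *)
Lemma expect_noise s k (H : 'T_(inr (inr s)) -> R) : bmf H ->
  \int[P]_t (H t * noise s k t) = 0.
Proof.
move=> bH; have bHP := bmf_off bH.
have mw : measurable_fun (setT : set 'T_(inr (inr s))) (freq k) by exact: measurable_freq_off.
have mb : measurable_fun (setT : set 'T_(inr (inr s))) (B k) by exact: measurable_phase_off.
have bc := bmf_cos_dotv_prod mw mb.
have bf := bmfM (bmf_comp measurable_fst bH) bc.
have bcP : @bmf R _ T (fun t => H t * cos (dotv (freq k t) (V s t) + B k t)).
  by apply: bmfM => //; apply: bmf_cos_dotv; [exact: measurable_freq|exact: (lawV s).1|exact: measurable_phase].
have bmP : @bmf R _ T (fun t => H t * feature_mean (rho s) k t).
  by apply: bmfM => //; exact: bmf_feature_mean.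
transitivity (\int[P]_t (sgnV s * Num.sqrt (2 / D%:R) *
   (H t * cos (dotv (freq k t) (V s t) + B k t) - H t * feature_mean (rho s) k t))).
  by apply: eq_Rintegral => t _; rewrite /noise; ring.
rewrite expectZl; last exact: bmfB.
rewrite expectB//.
have /= -> := expect_indep ET EI Em indE (lawV s) (EV s) bf.
have -> : \int[P]_t (H t * feature_mean (rho s) k t) =
    \int[P]_t \int[rho s]_x (H t * cos (dotv (freq k t) x + B k t)).
  by apply: eq_Rintegral => t _; rewrite expectZl//; exact: (bmf_section1 bc t).
by rewrite subrr mulr0.
Qed.

Lemma sum_noise2_le8 s t : \sum_k noise s k t ^+ 2 <= 8.
Proof.
have D0 : 0 < D%:R :> R by rewrite ltr0n.
apply: (@le_trans _ _ (\sum_(k < D) (8 / D%:R))).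
  apply: ler_sum => k _; rewrite /noise exprMn exprMn sqr_sqrtr ?divr_ge0//.
  have -> : sgnV s ^+ 2 = 1 by rewrite /sgnV; case: s => _; rewrite ?expr1n ?sqrrN ?expr1n.
  rewrite mul1r mulrAC ler_pM2r ?invr_gt0//.
  have := mean_cos_le1 (rho s) (freq k t) (B k t); have := cos_max (dotv (freq k t) (V s t) + B k t).
  rewrite /feature_mean !ler_norml => /andP[? ?] /andP[? ?]; nra.
by rewrite sumr_const card_ord -[leLHS]mulr_natr divfK// gt_eqF.
Qed.

Let partial_noise (l : seq ('I_n + 'I_n)) k t := \sum_(s <- l) noise s k t.

(** One term is removed at a time by [sqrt_step], which costs 4 lam / alpha. Its linear part z
    satisfies |z| <= 3, so lam z <= 1/2 and [expR_le_quad] applies; 2 z^2 <= 18 gives the quadratic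
    cost. *)
Lemma noise_mgf (alpha lam : R) (l : seq ('I_n + 'I_n)) :
  0 < alpha -> 0 <= lam -> lam * 3 <= 2^-1 -> uniq l ->
  \int[P]_t expR (lam * Num.sqrt (alpha ^+ 2 + \sum_k partial_noise l k t ^+ 2)) <=
  expR (lam * alpha + (size l)%:R * (18 * lam ^+ 2 + 4 * lam / alpha)).
Proof.
move=> a0 lam0 lam3; elim: l => [|s l IH] /=.
  move=> _; rewrite mul0r addr0.
  rewrite -[leRHS](expect_cst P) le_eqVlt; apply/orP; left; apply/eqP.
  apply: eq_Rintegral => t _; rewrite big1 => [|k _].
    by rewrite addr0 sqrtr_sqr gtr0_norm.
  by rewrite /partial_noise big_nil expr0n.
move=> /andP[sl ul].
pose q t := Num.sqrt (alpha ^+ 2 + \sum_k partial_noise l k t ^+ 2).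
have qa t : alpha <= q t.
  rewrite -[alpha]gtr0_norm// -sqrtr_sqr ler_wsqrtr// lerDl.
  by apply: sumr_ge0 => k _; exact: sqr_ge0.
have bvo k : @bmf R _ 'T_(inr (inr s)) (partial_noise l k).
  apply: bmf_sum_in => s' s'l; apply: bmf_noise_off.
  by apply: contraNneq sl => <-.
have bqo : @bmf R _ 'T_(inr (inr s)) q.
  by apply/bmf_sqrt/bmfD; [exact: bmf_cst|apply: bmf_sum => k; exact: bmfX].
(* Here alpha > 0 keeps q away from zero, so that 1/q is bounded. *)
have bqVo : @bmf R _ 'T_(inr (inr s)) (fun t => (q t)^-1).
  split; last first.
    exists alpha^-1 => t; rewrite ger0_norm ?invr_ge0 ?(le_trans (ltW a0) (qa t))//.
    by rewrite lef_pV2 ?posrE ?(lt_le_trans a0 (qa t)).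
  rewrite (_ : (fun t => _) = (fun x => x `^ (-1)) \o q).
    by apply: measurableT_comp; [exact: measurable_powR|exact: bqo.1].
  by apply/funext => t /=; rewrite powR_inv1// (le_trans (ltW a0)).
have bGo : @bmf R _ 'T_(inr (inr s)) (fun t => expR (lam * q t)).
  exact/bmf_expR/bmfZ.
have bHo k : @bmf R _ 'T_(inr (inr s)) (fun t => expR (lam * q t) * (partial_noise l k t / q t)).
  by apply: bmfM => //; exact: bmfM.
have bG := bmf_off bGo.
have bHn k : bmf (fun t => expR (lam * q t) * (partial_noise l k t / q t) * noise s k t).
  by apply: bmfM; [exact: (bmf_off (bHo k))|exact: bmf_noise].
have bS : bmf (fun t => \sum_k expR (lam * q t) * (partial_noise l k t / q t) * noise s k t).
  exact: bmf_sum.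
have b1 : bmf (fun t => expR (lam * Num.sqrt (alpha ^+ 2 + \sum_k partial_noise (s :: l) k t ^+ 2))).
  apply/bmf_expR/bmfZ/bmf_sqrt/bmfD; first exact: bmf_cst.
  by apply: bmf_sum => k; apply/bmfX/bmf_sum => s'; exact: bmf_noise.
pose K := expR (4 * lam / alpha).
have b2 : bmf (fun t => K * ((1 + 18 * lam ^+ 2) * expR (lam * q t) +
    lam * \sum_k expR (lam * q t) * (partial_noise l k t / q t) * noise s k t)).
  by apply/bmfZ/bmfD; exact: bmfZ.
apply: (le_trans (expect_le P b1 b2 _)).
  move=> t.
  have [h1 h2] := sqrt_step (fun k => partial_noise l k t) a0 (sum_noise2_le8 s t).
  rewrite -/(q t) in h1 h2.
  have -> : \sum_k partial_noise (s :: l) k t ^+ 2 =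
      \sum_k (partial_noise l k t + noise s k t) ^+ 2.
    by apply: eq_bigr => k _; rewrite /partial_noise big_cons addrC.
  set z := \sum_k partial_noise l k t / q t * noise s k t in h1 h2.
  have -> : \sum_k expR (lam * q t) * (partial_noise l k t / q t) * noise s k t =
      expR (lam * q t) * z.
    by rewrite /z mulr_sumr; apply: eq_bigr => k _; ring.
  have e1 : expR (lam * Num.sqrt (alpha ^+ 2 + \sum_k (partial_noise l k t + noise s k t) ^+ 2))
      <= K * (expR (lam * q t) * expR (lam * z)).
    rewrite -!expRD ler_expR; apply: le_trans (ler_wpM2l lam0 h1) _.
    by rewrite le_eqVlt; apply/orP; left; apply/eqP; ring.
  apply: (le_trans e1); rewrite ler_wpM2l ?expR_ge0//.
  have -> : (1 + 18 * lam ^+ 2) * expR (lam * q t) + lam * (expR (lam * q t) * z) =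
     expR (lam * q t) * (1 + lam * z + 18 * lam ^+ 2) by ring.
  rewrite ler_wpM2l ?expR_ge0//.
  move: h2; rewrite ler_norml => /andP[z3 z3'].
  have lz : lam * z <= 2^-1 by apply: le_trans lam3; rewrite ler_wpM2l.
  apply: (le_trans (expR_le_quad lz)); rewrite lerD2l exprMn.
  have z9 : z ^+ 2 <= 9 by nra.
  have := ler_wpM2l (sqr_ge0 lam) z9; lra.
rewrite expectZl; last by apply: bmfD; exact: bmfZ.
(* The linear term vanishes: the s-th noise is centered given all other variables. *)
rewrite expectD; [|exact: bmfZ|exact: bmfZ].
rewrite !expectZl// expect_sum// big1 => [|k _]; last exact: expect_noise.
rewrite mulr0 addr0.
have := IH ul; rewrite -/q => h.
have I0 : 0 <= \int[P]_t expR (lam * q t) by apply: expect_ge0 => t; exact: expR_ge0.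
apply: (@le_trans _ _ (K * (expR (18 * lam ^+ 2) * expR (lam * alpha + (size l)%:R * (18 * lam ^+ 2 + 4 * lam / alpha))))).
  rewrite ler_wpM2l ?expR_ge0// ler_pM//; last exact: expR_ge1Dx.
  by rewrite addr_ge0// mulr_ge0// sqr_ge0.
rewrite -!expRD ler_expR -[(size l).+1%:R]natr1 le_eqVlt; apply/orP; left; apply/eqP; ring.
Qed.


Hypothesis n_gt0 : (0 < n)%N.

Let n0 : 0 < n%:R :> R. Proof. by rewrite ltr0n. Qed.

(** The vector S/n of the header. *)
Definition mean_noise t k := n%:R^-1 * \sum_s noise s k t.

Lemma noise_tail (e : R) : 0 < e -> e <= 24 ->
  exists f : T -> R, [/\ bmf f, forall t, 0 <= f t,
    forall t, e <= l2norm (mean_noise t) -> 1 <= f t &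
    \int[P]_t f t <= 2 * expR (- (n%:R * e ^+ 2 / 288))].
Proof.
(* With these choices the exponent is n e^2 (-1/144 + 1/576 + 1/576) + 2/9, that is 2/9 - n e^2 /
   288, and exp(2/9) <= 2. The bound e <= 24 ensures 3 lam <= 1/2. *)
move=> e0 e24; pose lam := e / 144; pose alpha := n%:R * e / 4.
have a0 : 0 < alpha by rewrite divr_gt0// mulr_gt0.
have lam0 : 0 <= lam by rewrite divr_ge0// ltW.
have lam3 : lam * 3 <= 2^-1 by rewrite /lam; lra.
pose g t := expR (lam * Num.sqrt (alpha ^+ 2 + \sum_k (\sum_s noise s k t) ^+ 2)).
have bg : bmf g.
  apply/bmf_expR/bmfZ/bmf_sqrt/bmfD; first exact: bmf_cst.
  by apply: bmf_sum => k; apply/bmfX/bmf_sum => s; exact: bmf_noise.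
exists (fun t => expR (- (lam * (n%:R * e))) * g t); split.
- exact: bmfZ.
- by move=> t; rewrite mulr_ge0 ?expR_ge0.
- move=> t h; rewrite -expRD -[leLHS]expR0 ler_expR addrC subr_ge0 ler_wpM2l//.
  have ne0 : 0 <= n%:R * e by rewrite mulr_ge0// ltW.
  rewrite -[leLHS]ger0_norm// -sqrtr_sqr ler_wsqrtr//.
  apply: (@le_trans _ _ (\sum_k (\sum_s noise s k t) ^+ 2)); last first.
    by rewrite lerDr sqr_ge0.
  have N0 : 0 <= \sum_k mean_noise t k ^+ 2 by apply: sumr_ge0 => k _; exact: sqr_ge0.
  have -> : \sum_k (\sum_s noise s k t) ^+ 2 = n%:R ^+ 2 * \sum_k mean_noise t k ^+ 2.
    rewrite mulr_sumr; apply: eq_bigr => k _.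
    by rewrite /mean_noise -exprMn mulVKf// gt_eqF.
  rewrite exprMn ler_wpM2l ?sqr_ge0// -(sqr_sqrtr N0).
  by rewrite ler_pXn2r ?nnegrE ?sqrtr_ge0// ltW.
- rewrite expectZl//.
  have := noise_mgf a0 lam0 lam3 (index_enum_uniq ('I_n + 'I_n)%type).
  rewrite -sum1_size sum_nat_const muln1 card_sum card_ord => h.
  apply: le_trans (ler_wpM2l (expR_ge0 _) h) _; rewrite -expRD.
  have -> : - (lam * (n%:R * e)) + (lam * alpha + (n + n)%:R * (18 * lam ^+ 2 + 4 * lam / alpha))
      = 2 / 9 + - (n%:R * e ^+ 2 / 288).
    by rewrite natrD /lam /alpha; field; rewrite !gt_eqF.
  rewrite expRD ler_wpM2r ?expR_ge0//.
  apply: le_trans (expR_le_quad _) _; lra.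
Qed.

(** The decomposition m + S/n: the mean given the features is added and subtracted in each sample
    term. *)
Lemma mean_feature_diff t k :
  mean_feature (freq ^~ t) (B ^~ t) (X ^~ t) k -
  mean_feature (freq ^~ t) (B ^~ t) (Y ^~ t) k =
  Num.sqrt (2 / D%:R) * (feature_mean rho1 k t - feature_mean rho2 k t) + mean_noise t k.
Proof.
rewrite /mean_noise big_sumType /mean_feature /rff /noise /=.
set r := Num.sqrt _; set c1 := feature_mean rho1 k t; set c2 := feature_mean rho2 k t.
have -> : \sum_i 1 * r * (cos (dotv (freq k t) (X i t) + B k t) - c1) =
    \sum_i r * cos (dotv (freq k t) (X i t) + B k t) - n%:R * (r * c1).
  rewrite -[n in n%:R]card_ord mulr_natl -sumr_const -sumrB.
  by apply: eq_bigr => i _; ring.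
have -> : \sum_i -1 * r * (cos (dotv (freq k t) (Y i t) + B k t) - c2) =
    n%:R * (r * c2) - \sum_i r * cos (dotv (freq k t) (Y i t) + B k t).
  rewrite -[n in n%:R]card_ord mulr_natl -sumr_const -sumrB.
  by apply: eq_bigr => i _; ring.
by field; rewrite gt_eqF.
Qed.

Lemma l2norm_feature_mean t :
  l2norm (fun k => Num.sqrt (2 / D%:R) * (feature_mean rho1 k t - feature_mean rho2 k t))
  = Num.sqrt (feature_dist2 t).
Proof.
rewrite /l2norm /feature_dist2 mulr_sumr; congr Num.sqrt; apply: eq_bigr => k _.
by rewrite exprMn sqr_sqrtr ?divr_ge0// /feature_gap2; ring.
Qed.

(** * The deviation bound *)

Let gap t := l2norm (fun k => mean_feature (freq ^~ t) (B ^~ t) (X ^~ t) k -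
  mean_feature (freq ^~ t) (B ^~ t) (Y ^~ t) k).

Lemma measurable_gap : measurable_fun setT gap.
Proof.
rewrite /gap; under eq_fun do under eq_fun do rewrite mean_feature_diff.
apply: (bmf_sqrt _).1; apply: bmf_sum => k; apply/bmfX/bmfD.
  by apply/bmfZ/bmfB; exact: bmf_feature_mean.
by apply/bmfZ/bmf_sum => s; exact: bmf_noise.
Qed.

(** Averages of cosines differ by at most 2, so the squared norm is at most D (2/D) 4 = 8 < 9. This
    settles large eps. *)
Lemma gap_bounds t : 0 <= gap t < 3.
Proof.
rewrite sqrtr_ge0 -[ltRHS]ger0_norm// -sqrtr_sqr /gap /l2norm ltr_sqrt ?exprn_gt0//.
have D0 : 0 < D%:R :> R by rewrite ltr0n.
have mf (xs : 'I_n -> d.-tuple R) k :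
    `|n%:R^-1 * \sum_i cos (dotv (freq k t) (xs i) + B k t)| <= 1.
  rewrite normrM gtr0_norm ?invr_gt0// mulrC ler_pdivrMr// mul1r.
  apply: (le_trans (ler_norm_sum _ _ _)); rewrite -[n in n%:R]card_ord -sumr_const.
  by apply: ler_sum => i _; exact: cos_max.
apply: (@le_lt_trans _ _ (\sum_(k < D) (8 / D%:R))); last first.
  by rewrite sumr_const card_ord -[ltLHS]mulr_natr divfK ?gt_eqF//; lra.
apply: ler_sum => k _; rewrite /mean_feature /rff -!mulr_sumr.
have -> r x y : n%:R^-1 * (r * x) - n%:R^-1 * (r * y) = r * (n%:R^-1 * x - n%:R^-1 * y) :> R by ring.
rewrite exprMn sqr_sqrtr ?divr_ge0// mulrAC ler_pM2r ?invr_gt0//.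
have := mf (X ^~ t) k; have := mf (Y ^~ t) k.
move: (n%:R^-1 * _) (n%:R^-1 * _) => a b.
rewrite !ler_norml => /andP[? ?] /andP[? ?]; nra.
Qed.

Lemma rff_concentration (eps : R) : 0 < eps ->
  (P [set t | (3 / 4 * eps <= `|gap t - mmd|)%R]
   <= (2 * expR (- (n%:R * (4608^-1) * eps ^+ 2))
       + 32 / eps ^+ 2 * expR (- (D%:R * eps ^+ 2) / (64 * (d%:R + 2)))
       + 6 * expR (- (n%:R * eps ^+ 2) / 8))%:E)%E.
Proof.
move=> e0; have e20 : 0 < eps ^+ 2 by rewrite exprn_gt0.
have rhs0 : 0 <= 32 / eps ^+ 2 * expR (- (D%:R * eps ^+ 2) / (64 * (d%:R + 2))) + 6 * expR (- (n%:R * eps ^+ 2) / 8).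
  by rewrite addr_ge0 ?mulr_ge0 ?expR_ge0 ?invr_ge0 ?(ltW e20).
(* For eps >= 4 the threshold is at least 3, whereas both the gap and MMD lie in [0, 3). *)
have [e4|e4] := leP 4 eps.
  rewrite (_ : [set t | _] = set0) ?measure0.
    rewrite lee_fin -addrA; apply: addr_ge0; last exact: rhs0.
    by apply: mulr_ge0; [exact: ler0n|exact: expR_ge0].
  apply/seteqP; split => // t /=.
  have /andP[g0 g3] := gap_bounds t.
  have m0 : 0 <= mmd by exact: sqrtr_ge0.
  have m3 : mmd < 3.
    have /andP[_ M8] := MMD2_bounds (Ordinal D_gt0).
    rewrite -[ltRHS]ger0_norm// -sqrtr_sqr ltr_sqrt ?exprn_gt0//; lra.
  by apply/negP; rewrite -ltNge ltr_norml; lra.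
(* The threshold splits as 3/4 = 1/4 + 1/2, for the noise and for the features. *)
have [f1 [bf1 f10 f11 If1]] := @noise_tail (eps / 4) ltac:(lra) ltac:(lra).
have [f2 [bf2 f20 f21 If2]] := @feature_upper_tail (eps / 2) ltac:(lra).
have [f3 [bf3 f30 f31 If3]] := @feature_lower_tail (eps / 2) ltac:(lra).
have mA : measurable [set t | (3 / 4 * eps <= `|gap t - mmd|)%R].
  rewrite (_ : [set t | _] = (fun t => `|gap t - mmd|) @^-1` `[(3 / 4 * eps)%R, +oo[%classic); last first.
    by apply/seteqP; split => t /=; rewrite in_itv/= andbT.
  rewrite -[X in measurable X]setTI.
  have mg : measurable_fun setT (fun t => `|gap t - mmd|).
    apply: (measurableT_comp (@normr_measurable R setT)).
    by apply: measurable_funB => //; exact: measurable_gap.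
  by apply: mg => //; exact: measurable_itv.
have bf : bmf (fun t => f1 t + (f2 t + f3 t)) by apply: bmfD => //; exact: bmfD.
apply: (le_trans (prob_le_expect P mA bf _ _)).
- by move=> t; rewrite !addr_ge0.
- move=> t /= At.
  (* If the noise is below eps/4, the triangle inequality forces |m| to deviate from MMD by at least
     eps/2, on one side or the other. *)
  have [n1|n1] := leP (eps / 4) (l2norm (mean_noise t)).
    by rewrite (le_trans (f11 t n1))// lerDl addr_ge0.
  pose m k := Num.sqrt (2 / D%:R) * (feature_mean rho1 k t - feature_mean rho2 k t).
  have gE : gap t = l2norm (fun k => m k + mean_noise t k).
    by rewrite /gap /l2norm; congr Num.sqrt; apply: eq_bigr => k _; rewrite mean_feature_diff.
  have h1 : gap t <= l2norm m + l2norm (mean_noise t) by rewrite gE l2norm_triangle.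
  have h2 : l2norm m <= gap t + l2norm (mean_noise t).
    rewrite gE (_ : l2norm (mean_noise t) = l2norm (fun k => - mean_noise t k)).
      rewrite [leLHS](_ : _ = l2norm (fun k => (m k + mean_noise t k) + - mean_noise t k)).
        exact: l2norm_triangle.
      by congr Num.sqrt; apply: eq_bigr => k _; rewrite addrK.
    by congr Num.sqrt; apply: eq_bigr => k _; rewrite sqrrN.
  have mE : l2norm m = Num.sqrt (feature_dist2 t) by exact: l2norm_feature_mean.
  have /orP[h|h] : (mmd + eps / 2 <= l2norm m) || (l2norm m <= mmd - eps / 2).
    rewrite -[_ || _]negbK negb_or -!ltNge; apply/negP => /andP[u1 u2].
    by move: At; apply/negP; rewrite -ltNge ltr_norml; lra.
  + by rewrite (le_trans (f21 t _)) -?mE// addrCA lerDl addr_ge0.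
  + by rewrite (le_trans (f31 t _)) -?mE// addrA lerDr addr_ge0.
rewrite lee_fin expectD//; last exact: bmfD.
rewrite expectD//.
(* The constant 4608 is 288 times 4^2. *)
have c1 : 2 * expR (- (n%:R * (eps / 4) ^+ 2 / 288)) = 2 * expR (- (n%:R * 4608^-1 * eps ^+ 2)).
  by congr (2 * expR (- _)); field.
(* The two feature tails give the factor 2 <= 32 / eps^2, as eps < 4. Their rate D eps^2 / 128 is at
   least the claimed one because d + 2 >= 2. *)
have c2 : 2 * expR (- (D%:R * (eps / 2) ^+ 2 / 32)) <=
    32 / eps ^+ 2 * expR (- (D%:R * eps ^+ 2) / (64 * (d%:R + 2))).
  rewrite ler_pM ?expR_ge0//.
    rewrite ler_pdivlMr//; have : eps ^+ 2 <= 4 ^+ 2 by rewrite ler_pXn2r ?nnegrE ?ltW.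
    lra.
  rewrite ler_expR mulNr lerN2.
  have -> : D%:R * (eps / 2) ^+ 2 / 32 = (D%:R * eps ^+ 2) / 128 by field.
  have d0 : (0 : R) <= d%:R by exact: ler0n.
  apply: ler_wpM2l; first by apply: mulr_ge0; [exact: ler0n|exact: ltW].
  by rewrite lef_pV2 ?posrE; lra.
have c3 : 0 <= 6 * expR (- (n%:R * eps ^+ 2) / 8) by rewrite mulr_ge0 ?expR_ge0.
lra.
Qed.

End experiment.

Theorem theorem1 (R : realType) (d : nat) (sigma : R) (hsigma : 0 < sigma) :
  exists c : R, 0 < c /\ exists C : R, 0 < C /\
  forall (dT : measure_display) (T : measurableType dT) (P : probability T R)
    (rho1 rho2 : probability (d.-tuple R) R) (D n : nat) (eps : R)
    (W : 'I_D -> 'I_d -> T -> R) (B : 'I_D -> T -> R)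
    (X Y : 'I_n -> T -> d.-tuple R),
    (0 < D)%N -> (0 < n)%N -> 0 < eps ->
    (* w_k ~ N(0, sigma^-2 I_d): i.i.d. N(0, sigma^-2) coordinates *)
    (forall k j, has_law P (W k j) (normal_prob 0 sigma^-1)) ->
    (* b_k ~ U(0, 2 pi) *)
    (forall k, has_law P (B k) unif_0_2pi) ->
    (forall i, has_law P (X i) rho1) ->
    (forall i, has_law P (Y i) rho2) ->
    mutually_independent P (rff_events W B X Y) ->
    let w := fun t k => [tuple W k j t | j < d] in
    let phi1 := fun t => mean_feature (w t) (fun k => B k t) (fun i => X i t) in
    let phi2 := fun t => mean_feature (w t) (fun k => B k t) (fun i => Y i t) in
    (P [set t | (3 / 4 * eps <=
        `| l2norm (fun k => phi1 t k - phi2 t k) - MMD sigma rho1 rho2 |)%R ]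
     <= (2 * expR (- (n%:R * c * eps ^+ 2))
         + C / eps ^+ 2 * expR (- (D%:R * eps ^+ 2) / (64 * (d%:R + 2)))
         + 6 * expR (- (n%:R * eps ^+ 2) / 8))%:E)%E.
Proof.
exists 4608^-1; split; first by rewrite invr_gt0 ltr0n.
exists 32; split; first by rewrite ltr0n.
move=> dT T P rho1 rho2 D n eps W B X Y D0 n0 e0 lW lB lX lY ind /=.
exact: (rff_concentration hsigma lW lB lX lY ind D0 n0 e0).
Qed.
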